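(* Applying the Schreier–Reidemeister theorem to $\Gamma_0$, $\phi:\Gamma_0\to G$ and $\Gamma=\ker\phi$, followed by the elimination procedures (elliptic elimination, gluing, $M$-elimination) in their specified order of execution, gives an algorithm whose output is a set of $2g$ generators for $\Gamma$ and a single defining relation in which every generator and its inverse occurs.
   Context: Setting. $S$ is a compact Riemann surface of genus $g\ge2$, $G$ a group of conformal automorphisms of $S$ of order $n$, $S_0=S/G$ of genus $g_0$. $\Gamma$ and $\Gamma_0$ are Fuchsian groups acting on the unit disc $U$ with $S=U/\Gamma$, $S_0=U/\Gamma_0$; $\phi:\Gamma_0\to G$ is the surjective surface kernel homomorphism with kernel $\Gamma$. $\Gamma_0$ has the presentation $$\langle a_1,\dots,a_{g_0},b_1,\dots,b_{g_0},x_1,\dots,x_r\mid R=\textstyle\prod_{i=1}^{g_0}[a_i,b_i]\cdot x_1\cdots x_r=1,\ x_i^{m_i}=1\rangle,\quad m_i\ge2,$$ where $\phi(x_i)$ has order $m_i$ and $[a,b]=aba^{-1}b^{-1}$. Coset representatives. After applying an automorphism of $\Gamma_0$, assume $m_1\le\dots\le m_r$. Order the letters by $x_1<\dots<x_r<a_1<a_1^{-1}<\dots<a_{g_0}<a_{g_0}^{-1}<b_1<b_1^{-1}<\dots<b_{g_0}<b_{g_0}^{-1}$ (the $x_i^{-1}$ are omitted), and take as right coset representatives $K$ of $\Gamma_0$ modulo $\Gamma$ the $n$ first (shortest, lexicographically first) elements in the induced short-lex order; they form a minimal Schreier system (every initial segment of a representative is a representative, each of minimal length in its coset). $\overline X$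 is the representative of the coset of $X$ and $S_{K,v}=Kv\,\overline{Kv}^{\,-1}$ for a representative $K$ and a generator $v$. Schreier–Reidemeister presentation. For a word $X=c_1^{\epsilon_1}\cdots c_u^{\epsilon_u}$ in $\Gamma$ ($c_i$ generators of $\Gamma_0$, $\epsilon_i=\pm1$), $\tau(X)=\prod_{i=1}^u S_{V_i,c_i}^{\epsilon_i}$ with $V_i=\overline{c_1^{\epsilon_1}\cdots c_{i-1}^{\epsilon_{i-1}}}$ if $\epsilon_i=1$ and $V_i=\overline{c_1^{\epsilon_1}\cdots c_{i-1}^{\epsilon_{i-1}}c_i^{-1}}$ if $\epsilon_i=-1$. The group $\Gamma$ is presented by the generators $S_{K,v}$ with relations $\tau(KRK^{-1})=1$ ($R$-relations), $\tau(Kx_j^{m_j}K^{-1})=1$ (elliptic relations) and $S_{M,v}=1$ whenever $Mv=\overline{Mv}$ (these $S_{M,v}$ are the $M$-generators). Elimination procedures, in order. Step 1 (elliptic elimination): for each $i=1,\dots,r$ and each of the $n/m_i$ elliptic relations coming from $x_i$, solve the relation for one Schreier generator occurring in it and substitute wherever that generator occurs in an $R$-relation (e.g. from $\tau(x^m)=S_{1,x}S_{\overline x,x}\cdots S_{\overline{x^{m-1}},x}$ solve for $S_{\overline{x^{m-1}},x}$ and replace it by $(S_{1,x}S_{\overline x,x}\cdots S_{\overline{x^{m-2}},x})^{-1}$); this removes one generator and one relation each time. Step 2 (gluing, $n-1$ times): if two relations have the form $W_1XW_2$ and $V_1X^{-1}V_2$ with $X$ a generator, solve the second for $X$ and substitute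 in the first, eliminating $X$ and one $R$-relation; begin with $\tau(R)$, glue it along its first element $Q$ (not an $M$-generator) to the relation containing $Q^{-1}$, then repeat with the resulting relation until a single relation remains. Step 3 ($M$-elimination): replace every $M$-generator by $1$.
   Formalization: In elliptic elimination the generator solved for must not be an M-generator (otherwise more than 2g generators remain), and gluing uses the first non-M letter whose inverse lies in another relation, since the inverse of the first non-M letter may lie in the same relation. *)

(* Defs.v *)
From HB Require Import structures.
From mathcomp Require Export all_boot all_order all_algebra all_fingroup.

Set Implicit Arguments.
Unset Strict Implicit.
Unset Printing Implicit Defensive.

Import GroupScope.

(* A word over T: the letter (c, false) stands for c, (c, true) for c^-1. *)
Notation word T := (seq (T * bool)).

Definition linv (T : Type) (l : T * bool) : T * bool := (l.1, ~~ l.2).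

Definition winv (T : Type) (w : word T) : word T := rev (map (@linv T) w).

Definition ev (T : Type) (H : groupType) (f : T -> H) (w : word T) : H :=
  \prod_(l <- w) (if l.2 then (f l.1)^-1 else f l.1).

Definition free_red (T : eqType) (w : word T) : word T :=
  foldr (fun l u => if u is l' :: u' then
                      if l' == linv l then u' else l :: u
                    else [:: l]) [::] w.

Definition free_eq (T : eqType) (u v : word T) : bool :=
  free_red u == free_red v.

Definition word_over (T : eqType) (gens : seq T) (w : word T) : bool :=
  all (fun l => l.1 \in gens) w.

(* trivial_in gens rels w: the word w equals 1 in the group < gens | rels >. *)
Inductive trivial_in (T : eqType) (gens : seq T) (rels : seq (word T)) :
    word T -> Prop :=
| Tnil : trivial_in gens rels [::]
| Tins_free u v l : l.1 \in gens -> trivial_in gens rels (u ++ v) ->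
    trivial_in gens rels (u ++ [:: l; linv l] ++ v)
| Tdel_free u v l : trivial_in gens rels (u ++ [:: l; linv l] ++ v) ->
    trivial_in gens rels (u ++ v)
| Tins_rel u v w : w \in rels -> trivial_in gens rels (u ++ v) ->
    trivial_in gens rels (u ++ w ++ v)
| Tdel_rel u v w : w \in rels -> trivial_in gens rels (u ++ w ++ v) ->
    trivial_in gens rels (u ++ v).

(* The subgroup L of H has the presentation < gens | rels >, the symbol s
   being interpreted as the element f s of H. *)
Definition presents (T : eqType) (H : groupType) (L : H -> Prop)
    (gens : seq T) (f : T -> H) (rels : seq (word T)) : Prop :=
  [/\ forall s, s \in gens -> L (f s),
      forall h, L h -> exists2 w, word_over gens w & ev f w = h,
      all (word_over gens) rels
    & forall w, word_over gens w -> ev f w = 1 <-> trivial_in gens rels w].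

Definition in_kernel (H : groupType) (G : finGroupType)
    (phi : {multiplicative H -> G}) (h : H) : Prop := phi h = 1.

Inductive derived (H : groupType) (L : H -> Prop) : H -> Prop :=
| Der1 : derived L 1
| DerM u v d : L u -> L v -> derived L d -> derived L ([~ u, v] * d).

(* The genus of S = U / L: L acts freely on the contractible disc U, so L is
   the fundamental group of S and H_1(S, Z) is the abelianization of L; the
   genus is half the rank of H_1(S, Z) = Z^(2g). *)
Definition quotient_genus (H : groupType) (L : H -> Prop) (g : nat) : Prop :=
  exists h : H -> 'rV[int]_(2 * g),
  [/\ forall u v, L u -> L v -> h (u * v) = (h u + h v)%R,
      forall z, exists2 u, L u & h u = z
    & forall u, L u -> (h u = 0%R <-> derived L u)].

Definition fuchs_gen (g0 r : nat) : finType := ('I_r + ('I_g0 + 'I_g0))%type.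

Section Algorithm.

Variables (g0 r : nat).

Definition gx (i : 'I_r) : fuchs_gen g0 r := inl i.
Definition ga (i : 'I_g0) : fuchs_gen g0 r := inr (inl i).
Definition gb (i : 'I_g0) : fuchs_gen g0 r := inr (inr i).

Definition surface_rel : word (fuchs_gen g0 r) :=
  flatten [seq [:: (ga i, false); (gb i, false); (ga i, true); (gb i, true)]
          | i <- enum 'I_g0]
  ++ [seq (gx i, false) | i <- enum 'I_r].

Variable m : 'I_r -> nat.

Definition elliptic_rel (i : 'I_r) : word (fuchs_gen g0 r) :=
  nseq (m i) (gx i, false).

Definition rels0 : seq (word (fuchs_gen g0 r)) :=
  surface_rel :: [seq elliptic_rel i | i <- enum 'I_r].

(* The letters allowed in coset representatives, in increasing order. *)
Definition alphabet : word (fuchs_gen g0 r) :=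
  [seq (gx i, false) | i <- enum 'I_r]
  ++ flatten [seq [:: (ga i, false); (ga i, true)] | i <- enum 'I_g0]
  ++ flatten [seq [:: (gb i, false); (gb i, true)] | i <- enum 'I_g0].

(* The words of length k over the alphabet, in lexicographic order. *)
Fixpoint words_of_length (k : nat) : seq (word (fuchs_gen g0 r)) :=
  if k is k'.+1 then [seq l :: w | l <- alphabet, w <- words_of_length k']
  else [:: [::]].

(* q v is the image of the generator v in G = Gamma_0 / Gamma, so that the
   cosets of Gamma are the elements of G. *)
Variables (G : finGroupType) (q : fuchs_gen g0 r -> G).

(* The words of length < #|G|, in short-lex order; a minimal Schreier system
   with #|G| elements contains no longer word. *)
Definition short_words : seq (word (fuchs_gen g0 r)) :=
  flatten [seq words_of_length k | k <- iota 0 #|G|].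

Definition bar (X : word (fuchs_gen g0 r)) : word (fuchs_gen g0 r) :=
  head [::] [seq w <- short_words | ev q w == ev q X].

Definition reps : seq (word (fuchs_gen g0 r)) :=
  [seq w <- short_words | bar w == w].

(* The symbol S_{K,v} is the pair (K, v). *)
Definition sgen : eqType := (word (fuchs_gen g0 r) * fuchs_gen g0 r)%type.

Definition schreier_gens : seq sgen :=
  [seq (K, v) | K <- reps, v <- enum (fuchs_gen g0 r)].

Definition schreier_word (s : sgen) : word (fuchs_gen g0 r) :=
  rcons s.1 (s.2, false) ++ winv (bar (rcons s.1 (s.2, false))).

(* The equality Mv = \bar{Mv} is one between elements of the free group on
   the generators of Gamma_0. *)
Definition Mgen (s : sgen) : bool :=
  free_eq (rcons s.1 (s.2, false)) (bar (rcons s.1 (s.2, false))).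

(* In tau_from p X the word p is the part c_1^e_1 ... c_(i-1)^e_(i-1) that has
   already been read. *)
Fixpoint tau_from (p X : word (fuchs_gen g0 r)) : word sgen :=
  if X is (c, e) :: X' then
    ((bar (if e then rcons p (c, true) else p), c), e)
    :: tau_from (rcons p (c, e)) X'
  else [::].

Definition tau (X : word (fuchs_gen g0 r)) : word sgen := tau_from [::] X.

(* bar [::] = [::] is the first element of reps, so tau(R) is the first
   R-relation. *)
Definition R_relations : seq (word sgen) :=
  [seq tau (K ++ surface_rel ++ winv K) | K <- reps].

Definition elliptic_relation (i : 'I_r) (K : word (fuchs_gen g0 r)) : word sgen :=
  tau (K ++ elliptic_rel i ++ winv K).

(* Generators, and R-relations that are still present. *)
Notation state := (seq sgen * seq (word sgen))%type.

Definition initial : state := (schreier_gens, R_relations).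

Definition subst_gen (s : sgen) (u w : word sgen) : word sgen :=
  flatten [seq if l.1 == s then (if l.2 then winv u else u) else [:: l]
          | l <- w].

(* The solution of w = w1 s w2 = 1 for the generator s. *)
Definition solve_for (s : sgen) (w : word sgen) : word sgen :=
  let k := index (s, false) w in winv (drop k.+1 w ++ take k w).

(* The free choices of the elliptic elimination.  The relations of K and K'
   are conjugate when \bar{K'} = \bar{K x_i^j} for some j; e i lists, for one
   K out of each of these n / m_i classes, the pair of K and of the generator
   for which its relation is solved.  An M-generator cannot be chosen: its own
   relation s = 1 would become a new relation between other generators. *)
Definition elliptic_choice (e : 'I_r -> seq (word (fuchs_gen g0 r) * sgen)) : Prop :=
  forall i,
  [/\ {subset [seq t.1 | t <- e i] <= reps},
      forall K, K \in reps ->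
        count (fun t => ev q t.1 \in ev q K *: <[q (gx i)]>) (e i) = 1%N
    & forall t, t \in e i ->
        (t.2, false) \in elliptic_relation i t.1 /\ ~~ Mgen t.2].

Definition elliptic_step (i : 'I_r) (P : state)
    (t : word (fuchs_gen g0 r) * sgen) : state :=
  (rem t.2 P.1,
   [seq subst_gen t.2 (solve_for t.2 (elliptic_relation i t.1)) w | w <- P.2]).

Definition elliptic_elim (e : 'I_r -> seq (word (fuchs_gen g0 r) * sgen))
    (P : state) : state :=
  foldl (fun P' i => foldl (elliptic_step i) P' (e i)) P (enum 'I_r).

(* l can be glued: it is no M-generator and l^-1 occurs in another relation. *)
Definition gluable (others : seq (word sgen)) (l : sgen * bool) : bool :=
  ~~ Mgen l.1 && has (fun V => linv l \in V) others.

(* With W = W1 l W2 the current relation, l its first gluable letter, and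
   V = V1 l^-1 V2 the relation containing l^-1, so that l = V2 V1, the new
   current relation is W1 V2 V1 W2. *)
Definition glue_step (P : state) : state :=
  if P.2 is W :: others then
    if [seq l <- W | gluable others l] is l :: _ then
      let i := index l W in
      let j := find (fun V => linv l \in V) others in
      let V := nth [::] others j in
      let k := index (linv l) V in
      (rem l.1 P.1,
       (take i W ++ drop k.+1 V ++ take k V ++ drop i.+1 W)
       :: take j others ++ drop j.+1 others)
    else P
  else P.

Definition M_elim (P : state) : state :=
  ([seq s <- P.1 | ~~ Mgen s], [seq [seq l <- w | ~~ Mgen l.1] | w <- P.2]).

Definition algorithm (e : 'I_r -> seq (word (fuchs_gen g0 r) * sgen)) : state :=
  M_elim (iter #|G|.-1 glue_step (elliptic_elim e initial)).

End Algorithm.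

Arguments rels0 : clear implicits.

(* Main.v *)
From mathcomp Require Import zify cyclic.
Require Import Defs.

Set Implicit Arguments.
Unset Strict Implicit.
Unset Printing Implicit Defensive.

Import GroupScope.


(** The cosets of Gamma are the vertices, the Schreier generators the edges, the
    R-relations and the elliptic relations, one for each orbit of cosets under x_i,
    the faces of a cell structure on the surface S; the M-generators form a
    spanning tree of its edges, rooted at the trivial coset.  The algorithm
    removes edges between faces until one face remains, and then contracts the
    tree.

    The starting presentation is the Reidemeister-Schreier presentation
    (presents_schreier).  Each later step is a Tietze transformation: a relator
    is solved for a generator outside the tree, which is then eliminated
    (presents_elim and its special case presents_solve).  What has to be proved
    is that the steps can be carried out, that one relation is left, and that
    the remaining generators are 2g in number and occur in it with both signs.

    Every elliptic orbit contains an edge outside the tree, as the length of the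
    representative grows along the edges of the tree that are labelled x_i
    (ell_has_nonM); this makes the choices of the elliptic elimination possible.
    After that elimination every remaining edge outside the tree occurs once with
    each sign in the R-relations (count_eliminate_all), and gluing preserves this
    (glued_step).

    Gluing cannot stop early.  Otherwise the letters outside the tree would
    cancel in the current relation, so that its exponents form a cycle supported
    on a tree, which is zero (tree_cycle).  The set of faces already glued then
    has no boundary at all.  Regarded as a subset of G it is invariant under right
    multiplication by the images of all a_i, b_i and x_i, hence equal to G
    (faces_connected).

    In the final relation every exponent sum is zero, so that the abelianization
    of Gamma is free on the remaining generators; comparison with the definition
    of the genus gives their number (size_genus). *)

(** * Words and substitution *)

Section WordAlgebra.
Variable T : Type.
Implicit Types (u v w : word T) (l : T * bool).

Lemma linvK : involutive (@linv T).
Proof. by case=> x b; rewrite /linv /= negbK. Qed.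

Lemma winv_cat u v : winv (u ++ v) = winv v ++ winv u.
Proof. by rewrite /winv map_cat rev_cat. Qed.

Lemma winv_cons l w : winv (l :: w) = rcons (winv w) (linv l).
Proof. by rewrite /winv /= rev_cons. Qed.

Lemma winvK : involutive (@winv T).
Proof.
move=> w; rewrite /winv map_rev revK -map_comp -[RHS]map_id.
exact/eq_map/linvK.
Qed.

Variable H : groupType.
Implicit Type f : T -> H.

Lemma ev_nil f : ev f [::] = 1. Proof. exact: big_nil. Qed.

Lemma ev_cat f u v : ev f (u ++ v) = ev f u * ev f v.
Proof. exact: big_cat. Qed.

Lemma ev_cons f l w :
  ev f (l :: w) = (if l.2 then (f l.1)^-1 else f l.1) * ev f w.
Proof. exact: big_cons. Qed.

Lemma ev_linv f l : ev f [:: linv l] = (ev f [:: l])^-1.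
Proof. by case: l => x [] /=; rewrite !ev_cons !ev_nil !mulg1 /= ?invgK. Qed.

Lemma ev_rcons f w l : ev f (rcons w l) = ev f w * ev f [:: l].
Proof. by rewrite -cats1 ev_cat. Qed.

Lemma ev_winv f w : ev f (winv w) = (ev f w)^-1.
Proof.
elim: w => [|l w IHw]; first by rewrite !ev_nil invg1.
by rewrite winv_cons -(cat1s l) ev_rcons ev_cat invMg IHw ev_linv.
Qed.

Lemma eq_ev f1 f2 w : f1 =1 f2 -> ev f1 w = ev f2 w.
Proof. by move=> eqf; apply: eq_bigr => l _; rewrite eqf. Qed.

End WordAlgebra.

Section Morphisms.
Variables (H K : groupType) (phi : {multiplicative H -> K}).

Lemma mult1 : phi 1 = 1.
Proof. by apply: (mulgI (phi 1)); rewrite -gmulfM !mulg1. Qed.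

Lemma multV x : phi x^-1 = (phi x)^-1.
Proof. by apply: (mulgI (phi x)); rewrite -gmulfM !mulgV mult1. Qed.

Lemma ev_morph (T : Type) (f : T -> H) (w : word T) :
  phi (ev f w) = ev (fun t => phi (f t)) w.
Proof.
elim: w => [|l w IHw]; first by rewrite !ev_nil mult1.
by rewrite !ev_cons gmulfM IHw; case: l.2; rewrite ?multV.
Qed.
End Morphisms.

(** The homomorphism of free groups that extends th, on unreduced words. *)
Definition wsubst (T T' : Type) (th : T -> word T') (w : word T) : word T' :=
  flatten [seq if l.2 then winv (th l.1) else th l.1 | l <- w].

Section Substitution.
Variables (T T' : Type) (th : T -> word T').
Implicit Types (u v w : word T).

Lemma wsubst_cat u v : wsubst th (u ++ v) = wsubst th u ++ wsubst th v.
Proof. by rewrite /wsubst map_cat flatten_cat. Qed.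

Lemma wsubst1 s : wsubst th [:: (s, false)] = th s.
Proof. exact: cats0. Qed.

Lemma ev_wsubst (H : groupType) (f : T' -> H) w :
  ev f (wsubst th w) = ev (fun s => ev f (th s)) w.
Proof.
elim: w => [|l w IHw]; first by rewrite !ev_nil.
rewrite -(cat1s l) wsubst_cat !ev_cat IHw; congr (_ * _).
by case: l => x []; rewrite /wsubst /= ev_nil mulg1 ev_cons ev_nil mulg1 ?ev_winv.
Qed.
End Substitution.

Section Words.
Variable T : eqType.
Implicit Types (u v w : word T) (l : T * bool) (gens : seq T).

Lemma wsubst_id w (th : T -> word T) :
  {in [seq l.1 | l <- w], forall s, th s = [:: (s, false)]} -> wsubst th w = w.
Proof.
elim: w => // -[s b] w IHw thE; rewrite -(cat1s (s, b)) wsubst_cat IHw.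
  by rewrite /wsubst /= thE ?inE ?eqxx //= cats0; case: b {thE}.
by move=> t tw; apply: thE; rewrite inE tw orbT.
Qed.

Lemma word_over_cat gens u v :
  word_over gens (u ++ v) = word_over gens u && word_over gens v.
Proof. exact: all_cat. Qed.

Lemma word_over_winv gens w : word_over gens (winv w) = word_over gens w.
Proof. by rewrite /word_over /winv all_rev all_map; apply: eq_all. Qed.

Lemma sub_word_over gens gens' w :
  {subset gens <= gens'} -> word_over gens w -> word_over gens' w.
Proof. by move=> sub; apply: sub_all => l; apply: sub. Qed.

Lemma ev_free_red (H : groupType) (f : T -> H) w :
  ev f (free_red w) = ev f w.
Proof.
elim: w => //= l w; rewrite ev_cons => <-.
case: (free_red w) => [|l' u]; first by rewrite ev_cons.
case: eqP => [->|_]; last by rewrite ev_cons.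
by case: l => x [] /=; rewrite [in RHS]ev_cons /= ?mulKg ?mulVKg.
Qed.

Lemma free_red_cancel u l : free_red (u ++ [:: l; linv l]) = free_red u.
Proof. by rewrite /free_red foldr_cat /= eqxx. Qed.

End Words.

Lemma word_over_wsubst (T T' : eqType) (gens' : seq T') (gens : seq T)
    (th : T -> word T') w :
  (forall s, s \in gens -> word_over gens' (th s)) -> word_over gens w ->
  word_over gens' (wsubst th w).
Proof.
move=> thP; elim: w => // l w IHw /andP[lP /IHw wP].
rewrite -(cat1s l) wsubst_cat word_over_cat wP andbT /wsubst /= cats0.
by case: l.2; rewrite ?word_over_winv thP.
Qed.

(** * Consequences of relators *)

Section Consequences.
Variables (T : eqType) (gens : seq T) (rels : seq (word T)).
Hypothesis rels_over : all (word_over gens) rels.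
Implicit Types (a b u v w : word T) (l : T * bool).
Local Notation triv := (trivial_in gens rels).

Lemma triv_over w : triv w -> word_over gens w.
Proof.
elim=> // [u v l lP _|u v l _|u v w' wP _|u v w' wP _];
  rewrite !word_over_cat /=.
- by case/andP=> -> ->; rewrite lP.
- by case/andP=> -> /andP[_].
- by case/andP=> -> ->; rewrite (allP rels_over).
- by case/and3P=> -> _ ->.
Qed.

(** A trivial word may be inserted and deleted anywhere, since each step of a
    derivation can be replayed, or undone, in a context. *)
Lemma triv_context w a b : triv w -> triv (a ++ w ++ b) <-> triv (a ++ b).
Proof.
move=> tw; elim: tw a b => {w} [|u v l lP _ IH|u v l tw IH|u v w wP _ IH
  |u v w wP _ IH] a b //.
- apply: iff_trans (IH a b); rewrite -!catA; split; rewrite !(catA a u).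
    exact: Tdel_free.
  exact: Tins_free.
- have: word_over gens (u ++ [:: l; linv l] ++ v) by apply: triv_over.
  rewrite !word_over_cat /= => /and3P[_ /andP[lP _] _].
  apply: iff_trans (IH a b); rewrite -!catA; split; rewrite !(catA a u); first exact: Tins_free.
  exact: Tdel_free.
- apply: iff_trans (IH a b); rewrite -!catA; split; rewrite !(catA a u); first exact: Tdel_rel.
  exact: Tins_rel.
- apply: iff_trans (IH a b); rewrite -!catA; split; rewrite !(catA a u); first exact: Tins_rel.
  exact: Tdel_rel.
Qed.

(** Equality in the presented group; quantifying over contexts makes it at once
    an equivalence and a congruence for concatenation. *)
Definition weq u v := forall a b, triv (a ++ u ++ b) <-> triv (a ++ v ++ b).

Lemma weq_refl u : weq u u. Proof. by []. Qed.
Lemma weq_sym u v : weq u v -> weq v u.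
Proof. by move=> uv a b; rewrite uv. Qed.
Lemma weq_trans v u w : weq u v -> weq v w -> weq u w.
Proof. by move=> uv vw a b; rewrite uv. Qed.

Lemma weq_cat u u' v v' : weq u u' -> weq v v' -> weq (u ++ v) (u' ++ v').
Proof.
by move=> uu vv a b; rewrite -!catA uu [in X in X <-> _]catA vv -catA.
Qed.

Lemma triv_weq u v : weq u v -> triv u <-> triv v.
Proof. by move=> /(_ [::] [::]); rewrite !cats0. Qed.

Lemma weq_nil w : triv w <-> weq w [::].
Proof.
split=> [tw a b|/triv_weq ->]; first exact: triv_context.
exact: Tnil.
Qed.

Lemma triv_rel w : w \in rels -> triv w.
Proof. by move=> wP; have := Tins_rel wP (Tnil gens rels : triv ([::] ++ [::])); rewrite cats0. Qed.

Lemma triv_cat u v : triv u -> triv v -> triv (u ++ v).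
Proof. by move=> tu tv; apply/(triv_context [::] v tu). Qed.

Lemma triv_mulV w : word_over gens w -> triv (w ++ winv w).
Proof.
elim: w => [|l w IHw] /=; first by move=> _; apply: Tnil.
case/andP=> lP /IHw tw; rewrite winv_cons -cats1 -cat1s (catA w).
apply/(triv_context _ _ tw).
exact: (@Tins_free _ _ _ [::] [::] l lP (Tnil _ _)).
Qed.

Lemma triv_Vmul w : word_over gens w -> triv (winv w ++ w).
Proof.
by move=> wP; rewrite -{2}(winvK w); apply: triv_mulV; rewrite word_over_winv.
Qed.

Lemma triv_rot u v : word_over gens v -> triv (u ++ v) -> triv (v ++ u).
Proof.
move=> vP tuv; apply/(triv_weq (v := v ++ u ++ (v ++ winv v))).
  rewrite -{1}[u]cats0; do 2!apply: weq_cat => //.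
  exact/weq_sym/weq_nil/triv_mulV.
by rewrite [u ++ _]catA; apply/(triv_context v (winv v) tuv)/triv_mulV.
Qed.

Lemma triv_conj u w : word_over gens u -> triv w <-> triv (u ++ w ++ winv u).
Proof.
move=> uP; split=> [tw|]; first by apply/(triv_context _ _ tw)/triv_mulV.
have uP' : word_over gens (winv u) by rewrite word_over_winv.
rewrite catA => /(triv_rot uP'); rewrite catA => tw.
by apply/(triv_context [::] w (triv_Vmul uP)); rewrite -catA in tw *.
Qed.

Lemma triv_winv w : triv w -> triv (winv w).
Proof.
move=> tw; apply/(triv_context [::] (winv w) tw).
exact/triv_mulV/triv_over.
Qed.

Lemma weq_winv u v : word_over gens u -> word_over gens v ->
  weq u v -> weq (winv u) (winv v).
Proof.
move=> uP vP uv; apply: (weq_trans (v := winv u ++ (v ++ winv v))).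
  rewrite -{1}[winv u]cats0; apply: weq_cat => //.
  exact/weq_sym/weq_nil/triv_mulV.
apply: (weq_trans (v := (winv u ++ u) ++ winv v)).
  rewrite -catA; apply: weq_cat => //; apply: weq_cat => //; exact: weq_sym.
rewrite -[X in weq _ X]cat0s; apply: weq_cat => //.
exact/weq_nil/triv_Vmul.
Qed.

End Consequences.

(** * Tietze transformations *)

Section Tietze.
Variables (T : eqType).
Implicit Types (gens : seq T) (rels : seq (word T)).

(** A substitution that kills the relators induces a homomorphism between the
    presented groups. *)
Lemma triv_wsubst (T' : eqType) gens rels (gens' : seq T')
    (rels' : seq (word T')) (th : T -> word T') (w : word T) :
  all (word_over gens) rels -> all (word_over gens') rels' ->
  (forall s, s \in gens -> word_over gens' (th s)) ->
  (forall w', w' \in rels -> trivial_in gens' rels' (wsubst th w')) ->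
  trivial_in gens rels w -> trivial_in gens' rels' (wsubst th w).
Proof.
move=> relsO rels'O thP relsP.
have pairP u v l : l.1 \in gens ->
    trivial_in gens' rels' (wsubst th (u ++ [:: l; linv l] ++ v))
    <-> trivial_in gens' rels' (wsubst th (u ++ v)).
  move=> lP; rewrite !wsubst_cat; apply: triv_context => //.
  rewrite /wsubst /= cats0; case: l lP => s [] /= sP.
    exact/triv_Vmul/thP.
  exact/triv_mulV/thP.
have relP u v w' : w' \in rels ->
    trivial_in gens' rels' (wsubst th (u ++ w' ++ v))
    <-> trivial_in gens' rels' (wsubst th (u ++ v)).
  by move=> w'P; rewrite !wsubst_cat; apply: triv_context => //; apply: relsP.
elim=> [|u v l lP _|u v l tw|u v w' w'P _|u v w' w'P _]; first exact: Tnil.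
- by move/pairP; apply.
- move=> twth; have := triv_over relsO tw.
  by rewrite !word_over_cat /= => /and3P[_ /andP[lP _] _]; exact: (pairP u v l lP).1.
- by move/relP; apply.
- by move/relP; apply.
Qed.

Section Interpretation.
Variables (H : groupType) (L : H -> Prop) (f : T -> H).

Lemma ev_triv gens rels w :
  (forall w', w' \in rels -> ev f w' = 1) -> trivial_in gens rels w ->
  ev f w = 1.
Proof.
move=> relsP; elim=> {w} [|u v l _ _|u v l _|u v w' w'P _|u v w' w'P _].
- exact: ev_nil.
- by rewrite !ev_cat -(cat1s l) ev_cat ev_linv mulgV mul1g.
- by rewrite !ev_cat -(cat1s l) ev_cat ev_linv mulgV mul1g.
- by rewrite !ev_cat (relsP w') // mul1g.
- by rewrite !ev_cat (relsP w') // mul1g.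
Qed.

Lemma presents_rel gens rels w :
  presents L gens f rels -> w \in rels -> ev f w = 1.
Proof.
case=> _ _ relsO trivP wP; apply/trivP; first exact: (allP relsO).
exact: triv_rel.
Qed.

(** Tietze elimination.  Rewriting by th turns a derivation from rels into one
    from rels', and it fixes the words over gens', so that a word over gens'
    which is trivial for rels is trivial for rels'. *)
Lemma presents_elim gens rels gens' rels' (th : T -> word T) :
  presents L gens f rels ->
  {subset gens' <= gens} ->
  all (word_over gens') rels' ->
  (forall s, s \in gens -> word_over gens' (th s) /\ ev f (th s) = f s) ->
  (forall s, s \in gens' -> th s = [:: (s, false)]) ->
  (forall w, w \in rels' -> ev f w = 1) ->
  (forall w, w \in rels -> trivial_in gens' rels' (wsubst th w)) ->
  presents L gens' f rels'.
Proof.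
move=> [fL genL relsO trivP] sub rels'O thP thE rels'1 relsth; split=> //.
- by move=> s /sub/fL.
- move=> h /genL[w wO <-]; exists (wsubst th w).
    by apply: word_over_wsubst wO => s /thP[].
  rewrite ev_wsubst; elim: w wO => [|l w IHw]; first by rewrite !ev_nil.
  case/andP=> lP /IHw wE.
  by rewrite !ev_cons wE (thP _ lP).2.
move=> w wO; split=> [w1|]; last exact: ev_triv.
have -> : w = wsubst th w.
  rewrite wsubst_id // => s /mapP[l lw ->]; apply: thE; exact: (allP wO).
apply: triv_wsubst (relsO) _ _ relsth _ => // [s /thP[]//|].
by apply/trivP => //; apply: sub_word_over wO.
Qed.

Lemma presents_rels gens rels rels' :
  presents L gens f rels -> all (word_over gens) rels' ->
  (forall w, w \in rels' -> ev f w = 1) ->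
  (forall w, w \in rels -> trivial_in gens rels' w) ->
  presents L gens f rels'.
Proof.
move=> presL rels'O rels'1 relsP.
have [_ _ relsO _] := presL.
apply: (presents_elim (th := fun s => [:: (s, false)])) presL _ _ _ _ _ _ => //.
  by move=> s sP; rewrite /word_over /= sP ev_cons ev_nil mulg1.
by move=> w /relsP; rewrite wsubst_id.
Qed.

End Interpretation.
End Tietze.

(** * Short-lex minimal coset representatives *)

Lemma flatten_iota a b k :
  flatten [seq iota (a + i * b)%N b | i <- iota 0 k] = iota a (k * b).
Proof.
elim: k => // k IHk; rewrite mulSn addnC iotaD -IHk -[k.+1]addn1 iotaD.
by rewrite map_cat flatten_cat /= cats0 add0n.
Qed.

Section ShortLex.
Variables (g0 r : nat).
Local Notation X := (fuchs_gen g0 r).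
Local Notation A := (alphabet g0 r).
Local Notation N := (size A).
Implicit Types (u v w : word X) (l : X * bool).

Lemma mem_flatten_pairs (I : finType) (f : I -> X) l :
  l \in flatten [seq [:: (f i, false); (f i, true)] | i <- enum I] =
  [exists i, l.1 == f i].
Proof.
apply/flatten_mapP/existsP => [[i _]|[i /eqP li]].
  by rewrite !inE => /orP[] /eqP ->; exists i.
exists i; first by rewrite mem_enum.
by case: l li => v b /= ->; rewrite !inE !xpair_eqE eqxx; case: b.
Qed.

Lemma uniq_flatten_pairs (I : finType) (f : I -> X) :
  injective f ->
  uniq (flatten [seq [:: (f i, false); (f i, true)] | i <- enum I]).
Proof.
move=> injf; elim: (enum I) (enum_uniq I) => //= i s IHs /andP[iNs /IHs ->].
rewrite !inE xpair_eqE andbF andbT /=; apply/andP; split.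
  apply: contra iNs => /flatten_mapP[j js].
  by rewrite !inE !xpair_eqE !andbT ?andbF ?orbF => /eqP/injf->.
apply: contra iNs => /flatten_mapP[j js].
by rewrite !inE !xpair_eqE !andbT ?andbF => /eqP/injf->.
Qed.

Lemma mem_alphabet (x : X) b : ((x, b) \in A) = (if x is inl _ then ~~ b else true).
Proof.
rewrite /alphabet !mem_cat.
rewrite (mem_flatten_pairs (@ga g0 r)) (mem_flatten_pairs (@gb g0 r)) /=.
have -> : ((x, b) \in [seq (gx g0 i, false) | i <- enum 'I_r]) =
          [exists i, (x, b) == (gx g0 i, false)].
  apply/mapP/existsP => [[i _ ->]|[i /eqP->]]; exists i => //.
  by rewrite mem_enum.
case: x => [i|[i|i]].
- rewrite [X in _ || X](_ : _ = false) ?orbF; last first.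
    by apply/norP; split; apply/existsP => -[].
  apply/existsP/idP => [[j]|]; first by rewrite xpair_eqE => /andP[_ /eqP->].
  by move=> /negPf ->; exists i.
- by apply/or3P/Or32; apply/existsP; exists i.
- by apply/or3P/Or33; apply/existsP; exists i.
Qed.

Lemma alphabet_uniq : uniq A.
Proof.
rewrite /alphabet !cat_uniq !uniq_flatten_pairs; try by move=> i j [].
rewrite map_inj_uniq ?enum_uniq; last by move=> i j [].
rewrite /= andbT; apply/andP; split; apply/hasPn => -[v b].
  rewrite mem_cat (mem_flatten_pairs (@ga g0 r)) (mem_flatten_pairs (@gb g0 r)).
  move=> vab; apply/mapP => -[i _ [vi _]]; move: vab; rewrite /= vi.
  by case/orP=> /existsP[].
rewrite (mem_flatten_pairs (@gb g0 r)) => /existsP[i /= /eqP vi].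
by rewrite (mem_flatten_pairs (@ga g0 r)) /= vi; apply/existsP => -[].
Qed.

(** Bijective base-N numeration turns the short-lex order on words into the
    usual order on natural numbers. *)
Definition num w : nat :=
  foldl (fun a l => a * N + (index l A).+1)%N 0%N w.

Lemma num_rcons w l : num (rcons w l) = (num w * N + (index l A).+1)%N.
Proof. by rewrite /num foldl_rcons. Qed.

Lemma num_cons l w : num (l :: w) = ((index l A).+1 * N ^ size w + num w)%N.
Proof.
elim/last_ind: w => [|w l' IHw]; first by rewrite muln1 addn0.
by rewrite -rcons_cons !num_rcons IHw size_rcons mulnDl expnSr mulnA addnA.
Qed.

Lemma num_gt0 w : (0 < num w)%N = (w != [::]).
Proof. by case/lastP: w => // w l; rewrite num_rcons addnS -size_eq0 size_rcons. Qed.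

Lemma map_index_uniq (T : eqType) (s : seq T) :
  uniq s -> [seq index x s | x <- s] = iota 0 (size s).
Proof.
move=> us; case: s us => // x0 s us; apply: (@eq_from_nth _ 0%N).
  by rewrite size_map size_iota.
move=> i; rewrite size_map => ilt.
by rewrite (nth_map x0) // index_uniq // nth_iota.
Qed.

Fixpoint first_num k := if k is k'.+1 then (N ^ k' + first_num k')%N else 0%N.

Lemma mem_words_of_length k w :
  (w \in words_of_length g0 r k) = (size w == k) && all (mem A) w.
Proof.
elim: k w => [|k IHk] w /=; first by rewrite inE -size_eq0; case: w.
apply/allpairsP/idP => [[[l u] /= [lA uk ->]]|].
  by rewrite IHk /= eqSS in uk *; case/andP: uk => -> ->; rewrite lA.
case: w => // l w; rewrite /= eqSS => /andP[wk /andP[lA wA]].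
by exists (l, w); rewrite IHk wk.
Qed.

Lemma map_num_words k :
  [seq num w | w <- words_of_length g0 r k] = iota (first_num k) (N ^ k).
Proof.
elim: k => // k IHk /=; rewrite map_flatten -map_comp expnS -flatten_iota.
rewrite -(map_index_uniq alphabet_uniq) -map_comp; congr flatten.
apply: eq_map => l /=; rewrite -map_comp.
transitivity [seq ((index l A).+1 * N ^ k + j)%N | j <- iota (first_num k) (N ^ k)].
  rewrite -IHk -map_comp; apply/eq_in_map => w; rewrite mem_words_of_length.
  by case/andP=> /eqP wk _; rewrite /= num_cons wk.
by rewrite -iotaDl mulSn addnAC.
Qed.

Lemma num_bounds w : all (mem A) w ->
  (first_num (size w) <= num w < first_num (size w).+1)%N.
Proof.
move=> wA; have: num w \in [seq num w | w <- words_of_length g0 r (size w)].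
  by apply: map_f; rewrite mem_words_of_length eqxx.
by rewrite map_num_words mem_iota /= addnC.
Qed.

Lemma leq_first_num i j : (i <= j)%N -> (first_num i <= first_num j)%N.
Proof.
move=> /subnK <-; elim: (j - i)%N => // k /leq_trans; apply.
by rewrite addSn /= leq_addl.
Qed.

Lemma num_lt_size u v : all (mem A) u -> all (mem A) v ->
  (size u < size v)%N -> (num u < num v)%N.
Proof.
move=> /num_bounds/andP[_ uP] /num_bounds/andP[vP _] uv.
exact: leq_trans uP (leq_trans (leq_first_num uv) vP).
Qed.

Lemma num_inj u v : all (mem A) u -> all (mem A) v -> num u = num v -> u = v.
Proof.
move=> uA vA uv; have szE : size u = size v.
  case: (ltngtP (size u) (size v)) => // lt_sz.
    by have := num_lt_size uA vA lt_sz; rewrite uv ltnn.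
  by have := num_lt_size vA uA lt_sz; rewrite uv ltnn.
elim/last_ind: u v uA vA uv szE => [|u l IHu] v.
  by case: v.
case/lastP: v => [|v l']; first by rewrite size_rcons.
rewrite !all_rcons !size_rcons !num_rcons => /andP[lA uA] /andP[lA' vA].
rewrite !addnS => -[E] [szE].
have ltN: forall l, l \in A -> (index l A < N)%N by move=> l0; rewrite index_mem.
have N0 : (0 < N)%N by apply: leq_ltn_trans (ltN _ lA).
have idxE : index l A = index l' A.
  have := congr1 (modn^~ N) E; rewrite /= !modnMDl !modn_small //; exact: ltN.
have numE : num u = num v.
  have := congr1 (divn^~ N) E; rewrite /= !divnMDl // !divn_small ?addn0 //; exact: ltN.
congr rcons; first exact: IHu.
by rewrite -(nth_index l lA) idxE nth_index.
Qed.

End ShortLex.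

Section Representatives.
Variables (g0 r : nat) (G : finGroupType) (q : fuchs_gen g0 r -> G).
Hypothesis q_surj : forall y : G, exists X, ev q X = y.
Local Notation X := (fuchs_gen g0 r).
Local Notation A := (alphabet g0 r).
Local Notation short := (short_words g0 r G).
Local Notation bar := (bar q).
Local Notation reps := (reps q).
Implicit Types (u v w K Y : word X) (l : X * bool).

Lemma mem_short_words w : (w \in short) = (size w < #|G|)%N && all (mem A) w.
Proof.
apply/flatten_mapP/andP => [[k]|[wG wA]].
  rewrite mem_iota /= mem_words_of_length => kG /andP[/eqP wk wA].
  by rewrite wk.
exists (size w); first by rewrite mem_iota.
by rewrite mem_words_of_length eqxx.
Qed.

Lemma map_num_short : [seq num w | w <- short] = iota 0 (first_num g0 r #|G|).
Proof.
rewrite /short_words; elim: #|G| => // k IHk.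
rewrite -[k.+1]addn1 iotaD map_cat flatten_cat map_cat IHk /= cats0.
by rewrite map_num_words addn1 /= [(_ ^ _ + _)%N]addnC iotaD add0n.
Qed.

Lemma short_sorted : sorted (relpre (@num g0 r) ltn) short.
Proof. by rewrite -sorted_map map_num_short iota_ltn_sorted. Qed.

(** The inverses of the x_i are dispensable because they have finite order in
    G, and a word with at least #|G| letters takes some value twice along its
    initial segments, so that a factor may be dropped. *)
Lemma short_word_ex y : exists2 w, w \in short & ev q w = y.
Proof.
have [w wA <-] : exists2 w, all (mem A) w & ev q w = y.
  have : y \in <<[set q x | x : X]>>.
    have [Y <-] := q_surj y; elim: Y => [|[x b] Y IHY]; first by rewrite ev_nil group1.
    rewrite ev_cons groupM //=.
    have : q x \in <<[set q x | x : X]>> by apply/mem_gen/imset_f.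
    by case: b; rewrite ?groupV.
  case/gen_prodgP=> n [c cP ->].
  have /fin_all_exists[f fP] i : exists x, q x = c i.
    by case/imsetP: (cP i) => x _ ->; exists x.
  exists [seq (f i, false) | i <- enum 'I_n].
    by apply/allP => _ /mapP[i _ ->]; rewrite /= mem_alphabet; case: (f i).
  rewrite /ev big_map enumT [index_enum _]unlock; apply: eq_bigr => i _ /=; exact: fP.
have [k] := ubnP (size w); elim: k w wA => // k IHk w wA; rewrite ltnS => wk.
have [wG|Gw] := ltnP (size w) #|G|.
  by exists w => //; rewrite mem_short_words wG.
pose f (i : 'I_(size w).+1) := ev q (take i w).
have /injectivePn[i [j ij fij]] : ~~ injectiveb f.
  apply/negP => /injectiveP/leq_card; rewrite card_ord => ltG.
  by have := leq_trans ltG Gw; rewrite ltnn.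
wlog ltij : i j ij fij / (i < j)%N.
  move=> wl; move: (ij); rewrite -val_eqE neq_ltn => /orP[] lij; first exact: (wl i j).
  by apply: (wl j i) => //; rewrite eq_sym.
have jw : (j <= size w)%N by rewrite -ltnS.
have [||w' w'S w'E] := IHk (take i w ++ drop j w).
- by rewrite all_cat; apply/andP; split; apply/allP => l;
    [move/mem_take|move/mem_drop]; exact: (allP wA).
- rewrite size_cat size_take size_drop (leq_trans ltij jw).
  by apply: leq_trans wk; rewrite -[ltnRHS](subnKC jw) ltn_add2r.
exists w' => //; rewrite w'E ev_cat [ev q (take i w)]fij /f -ev_cat.
by rewrite cat_take_drop.
Qed.

(** The short words are enumerated by increasing num, so the first one in a
    coset has the least num. *)
Lemma bar_spec Y : [/\ bar Y \in short, ev q (bar Y) = ev q Y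
  & forall w, w \in short -> ev q w = ev q Y -> (num (bar Y) <= num w)%N].
Proof.
rewrite /Defs.bar; set s := [seq w <- _ | _].
have [w0 w0S w0Y] := short_word_ex (ev q Y).
have : w0 \in s by rewrite mem_filter w0Y eqxx.
have : sorted (relpre (@num g0 r) ltn) s.
  apply: sorted_filter short_sorted => u v w; exact: ltn_trans.
have sS : {subset s <= [seq w <- short | ev q w == ev q Y]} by [].
have sP w : w \in short -> ev q w = ev q Y -> w \in s.
  by move=> wS wY; rewrite mem_filter wY eqxx.
case: s sS sP => //= w s sS sP sorts _; have := sS w (mem_head _ _).
rewrite mem_filter => /andP[/eqP wY wS]; split=> // v vS vY.
have := sP v vS vY; rewrite inE => /predU1P[-> //|vs].
have /allP/(_ v vs) : all (relpre (@num g0 r) ltn w) s.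
  apply: order_path_min sorts => a b c; exact: ltn_trans.
exact: ltnW.
Qed.

Lemma ev_bar Y : ev q (bar Y) = ev q Y. Proof. by case: (bar_spec Y). Qed.

Lemma eq_bar Y Y' : ev q Y = ev q Y' -> bar Y = bar Y'.
Proof. by move=> YY; rewrite /Defs.bar YY. Qed.

Lemma bar_bar Y : bar (bar Y) = bar Y.
Proof. exact/eq_bar/ev_bar. Qed.

Lemma bar_reps Y : bar Y \in reps.
Proof. by rewrite mem_filter bar_bar eqxx; case: (bar_spec Y). Qed.

Lemma bar_id K : K \in reps -> bar K = K.
Proof. by rewrite mem_filter => /andP[/eqP]. Qed.

Lemma reps_inj : {in reps &, injective (ev q)}.
Proof. by move=> K K' KP K'P /eq_bar; rewrite !bar_id. Qed.

Lemma reps_short K : K \in reps -> K \in short.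
Proof. by rewrite mem_filter => /andP[]. Qed.

Lemma reps_alphabet K : K \in reps -> all (mem A) K.
Proof. by move/reps_short; rewrite mem_short_words => /andP[]. Qed.

Lemma num_reps_min K w : K \in reps -> w \in short -> ev q w = ev q K ->
  (num K <= num w)%N.
Proof.
move=> KP wS wK; rewrite -(bar_id KP); case: (bar_spec K) => _ _; exact.
Qed.

Lemma nil_reps : [::] \in reps.
Proof.
have nilS : [::] \in short by rewrite mem_short_words /= (cardD1 1).
have [_ _ /(_ _ nilS (erefl _))] := bar_spec [::].
rewrite leqn0 -[_ == _]negbK -lt0n num_gt0 negbK => /eqP nilE.
by rewrite -nilE bar_reps.
Qed.

Lemma bar_nil : bar [::] = [::]. Proof. exact/bar_id/nil_reps. Qed.

(** Representatives are closed under initial segments: a better initial segment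
    would give a better word. *)
Lemma reps_rcons w l : rcons w l \in reps -> w \in reps.
Proof.
move=> wlP; have := reps_short wlP.
rewrite mem_short_words size_rcons all_rcons => /andP[wlG /andP[lA wA]].
have wS : w \in short by rewrite mem_short_words wA (ltn_trans _ wlG).
have [bS bE bmin] := bar_spec w.
have bA : all (mem A) (bar w) by apply/reps_alphabet/bar_reps.
suff -> : w = bar w by apply: bar_reps.
apply: num_inj => //; apply/eqP; rewrite eqn_leq bmin // andbT.
have : (num (rcons w l) <= num (rcons (bar w) l))%N.
  apply: num_reps_min => //; last by rewrite !ev_rcons bE.
  rewrite mem_short_words size_rcons all_rcons lA bA !andbT.
  apply: leq_trans wlG; rewrite ltnS ltnNge; apply/negP => /num_lt_size.
  by rewrite ltnNge bmin // => /(_ wA bA).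
rewrite !num_rcons leq_add2r leq_pmul2r //.
by apply: leq_ltn_trans (_ : index l A < _)%N; rewrite // index_mem.
Qed.

(** A cancelling pair could be dropped without changing the coset. *)
Lemma reps_reduced u l v : u ++ l :: linv l :: v \notin reps.
Proof.
apply/negP => uP; have := reps_short uP.
rewrite mem_short_words size_cat all_cat /= => /andP[uG /and4P[uA _ _ vA]].
have /(num_reps_min uP) : u ++ v \in short.
  rewrite mem_short_words size_cat all_cat uA vA !andbT.
  by apply: leq_trans uG; rewrite ltnS leq_add2l -addn2 leq_addr.
have -> : ev q (u ++ v) = ev q (u ++ [:: l] ++ [:: linv l] ++ v).
  by rewrite !ev_cat ev_linv mulVKg.
move/(_ (erefl _)); apply/negP; rewrite -ltnNge; apply: num_lt_size.
- by rewrite all_cat uA vA.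
- exact: reps_alphabet uP.
by rewrite !size_cat ltn_add2l /= ltnS leqnSn.
Qed.

Lemma free_red_reps K : K \in reps -> free_red K = K.
Proof.
suff red u w : u ++ w \in reps -> free_red w = w by apply: (red [::]).
elim: w u => //= l w IHw u uP; rewrite (IHw (rcons u l)) ?cat_rcons //.
case: w {IHw} uP => // l' w uP; case: eqP => // l'E.
by have := reps_reduced u l w; rewrite -l'E uP.
Qed.

Lemma uniq_reps : uniq reps.
Proof.
apply: filter_uniq; apply: (@map_uniq _ _ (@num g0 r)).
by rewrite map_num_short iota_uniq.
Qed.

Lemma perm_reps : perm_eq [seq ev q K | K <- reps] (enum G).
Proof.
apply: uniq_perm; rewrite ?enum_uniq ?map_inj_in_uniq ?uniq_reps //.
  exact: reps_inj.
move=> y; rewrite mem_enum inE; have [Y <-] := q_surj y.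
by rewrite -ev_bar map_f // bar_reps.
Qed.

Lemma size_reps : size reps = #|G|.
Proof. by rewrite -(size_map (ev q)) (perm_size perm_reps) cardE. Qed.

End Representatives.

(** * The Reidemeister-Schreier presentation *)

Section Tau.
Variables (g0 r : nat) (G : finGroupType) (q : fuchs_gen g0 r -> G).
Hypothesis q_surj : forall y : G, exists X, ev q X = y.
Local Notation X := (fuchs_gen g0 r).
Local Notation bar := (bar q).
Local Notation reps := (reps q).
Local Notation gens := (schreier_gens q).
Local Notation Mgen := (Mgen q).
Local Notation tau := (tau q).
Local Notation tau_from := (tau_from q).
Implicit Types (u v w K Y p : word X) (l : X * bool) (s : sgen g0 r).

(** Only the coset reached by the part already read matters to tau. *)
Lemma eq_tau_from p p' Y : ev q p = ev q p' -> tau_from p Y = tau_from p' Y.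
Proof.
elim: Y p p' => //= -[x b] Y IHY p p' pp; congr ((_, _, _) :: _).
  by case: b; apply: eq_bar; rewrite ?ev_rcons pp.
by apply: IHY; rewrite !ev_rcons pp.
Qed.

Lemma tau_from_cat p u v :
  tau_from p (u ++ v) = tau_from p u ++ tau_from (p ++ u) v.
Proof.
elim: u p => [|[x b] u IHu] p /=; first by rewrite cats0.
by rewrite IHu cat_rcons.
Qed.

Lemma tau_from_winv p Y : tau_from (p ++ Y) (winv Y) = winv (tau_from p Y).
Proof.
elim: Y p => // l Y IHY p; rewrite winv_cons -cats1 tau_from_cat -cat_rcons IHY.
have -> : tau_from p (l :: Y) = tau_from p [:: l] ++ tau_from (rcons p l) Y.
  by rewrite -cat1s tau_from_cat cats1.
rewrite winv_cat; congr (_ ++ _).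
rewrite (eq_tau_from (p' := rcons p l)).
  case: l => x [] //=; congr [:: (_, _, _)]; apply: eq_bar.
  by rewrite -!cats1 -catA !ev_cat -ev_cat !ev_cons !ev_nil /= !mulg1 mulgV mulg1.
by rewrite !ev_cat ev_winv mulgK.
Qed.

Lemma tau_winv Y : ev q Y = 1 -> tau (winv Y) = winv (tau Y).
Proof.
by move=> Y1; rewrite -tau_from_winv; apply: eq_tau_from; rewrite Y1 ev_nil.
Qed.

Lemma mem_schreier_gens s : (s \in gens) = (s.1 \in reps).
Proof.
apply/allpairsP/idP => [[[K v] /= [KP _ ->]]//|sP].
by exists s; rewrite mem_enum; case: s sP.
Qed.

Lemma uniq_schreier_gens : uniq gens.
Proof.
by apply: allpairs_uniq; rewrite ?enum_uniq ?uniq_reps // => -[? ?] [? ?].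
Qed.

Lemma tau_from_over p Y : word_over gens (tau_from p Y).
Proof.
elim: Y p => //= -[x b] Y IHY p /=.
by rewrite mem_schreier_gens /= bar_reps // IHY.
Qed.

(** The path of a representative runs through its initial segments, which are
    representatives; each step therefore appends a letter or undoes one. *)
Lemma Mgen_rep K : K \in reps -> all (fun t => Mgen t.1) (tau K).
Proof.
elim/last_ind: K => // K [x b] IHK KP; have K'P := reps_rcons q_surj KP.
rewrite /Defs.tau -cats1 tau_from_cat all_cat IHK // /= andbT.
rewrite /Defs.Mgen /=; case: b KP => KP; rewrite (bar_id KP) || rewrite (bar_id K'P).
  have -> : bar (rcons (rcons K (x, true)) (x, false)) = K.
    rewrite -[RHS](bar_id K'P); apply: eq_bar.
    by rewrite !ev_rcons !ev_cons !ev_nil !mulg1 mulgVK.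
  by rewrite /free_eq -!cats1 -catA free_red_cancel.
by rewrite (bar_id KP) /free_eq.
Qed.

Lemma tau_conj K Y : K \in reps -> ev q Y = 1 ->
  tau (K ++ Y ++ winv K) = tau K ++ tau_from K Y ++ winv (tau K).
Proof.
move=> KP Y1; rewrite /Defs.tau !tau_from_cat cat0s; congr (_ ++ (_ ++ _)).
by rewrite -tau_from_winv; apply: eq_tau_from; rewrite ev_cat Y1 mulg1.
Qed.

Lemma tau_schreier_word s : s \in gens ->
  tau (schreier_word q s) =
  tau s.1 ++ [:: (s, false)] ++ winv (tau (bar (rcons s.1 (s.2, false)))).
Proof.
rewrite mem_schreier_gens; case: s => K x /= KP; rewrite /schreier_word /=.
rewrite -cats1 /Defs.tau !tau_from_cat cat0s /= (bar_id KP) -catA /=.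
congr (_ ++ _ :: _); rewrite -[in RHS]tau_from_winv; apply: eq_tau_from.
by rewrite cat0s ev_bar // cats1.
Qed.

Variables (Gamma0 : groupType) (c : X -> Gamma0).
Local Notation f := (fun s : sgen g0 r => ev c (schreier_word q s)).

(** The factors S_{K,v} of tau telescope. *)
Lemma ev_tau_from p Y :
  ev f (tau_from p Y) = ev c (bar p) * ev c Y * (ev c (bar (p ++ Y)))^-1.
Proof.
elim: Y p => [|[x b] Y IHY] p; first by rewrite !ev_nil cats0 mulg1 mulgV.
rewrite /= ev_cons IHY cat_rcons [in RHS]ev_cons !mulgA; congr (_ * _ * _).
rewrite /schreier_word; case: b => /=.
  have -> : bar (rcons (bar (rcons p (x, true))) (x, false)) = bar p.
    apply: eq_bar; rewrite !ev_rcons ev_bar // ev_rcons.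
    by rewrite !ev_cons !ev_nil !mulg1 mulgVK.
  rewrite ev_cat ev_rcons ev_winv invMg invgK invMg -!mulgA; congr (_ * _).
  by rewrite ev_cons ev_nil mulg1 mulVg mulg1.
have -> : bar (rcons (bar p) (x, false)) = bar (rcons p (x, false)).
  by apply: eq_bar; rewrite !ev_rcons ev_bar.
by rewrite ev_cat ev_rcons ev_winv mulgVK ev_cons ev_nil mulg1.
Qed.

Lemma ev_tau Y : ev q Y = 1 -> ev f (tau Y) = ev c Y.
Proof.
move=> Y1; rewrite ev_tau_from cat0s (eq_bar (Y' := [::])) ?Y1 ?ev_nil //.
by rewrite bar_nil // ev_nil mul1g invg1 mulg1.
Qed.

Lemma ev_Mgen s : Mgen s -> f s = 1.
Proof.
move=> /eqP eqM; rewrite /schreier_word ev_cat ev_winv.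
by rewrite -(ev_free_red c (rcons _ _)) eqM ev_free_red mulgV.
Qed.

End Tau.

(** The relators that identify the tree with a point; the states of the
    algorithm leave them implicit until its last step. *)
Definition Mrels g0 r (G : finGroupType) (q : fuchs_gen g0 r -> G)
  (gens : seq (sgen g0 r)) : seq (word (sgen g0 r)) :=
  [seq [:: (s, false)] | s <- gens & Mgen q s].

Section MTrivial.
Variables (g0 r : nat) (G : finGroupType) (q : fuchs_gen g0 r -> G).
Variables (gens : seq (sgen g0 r)) (rels : seq (word (sgen g0 r))).
Hypothesis rels_over : all (word_over gens) (rels ++ Mrels q gens).
Local Notation triv := (trivial_in gens (rels ++ Mrels q gens)).
Implicit Types (w : word (sgen g0 r)).

Lemma triv_M w : word_over gens w -> all (fun t => Mgen q t.1) w -> triv w.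
Proof.
elim: w => [|[s b] w IHw] /=; first by move=> _ _; apply: Tnil.
case/andP=> /= sP wP /andP[/= sM wM]; rewrite -cat1s.
apply: triv_cat (IHw wP wM) => //.
have sT : triv [:: (s, false)].
  apply: triv_rel; rewrite mem_cat; apply/orP; right.
  by apply/mapP; exists s => //; rewrite mem_filter sM.
by case: b => //; apply: (triv_winv _ sT).
Qed.
End MTrivial.

Section ReidemeisterSchreier.
Variables (g0 r : nat) (G : finGroupType) (Gamma0 : groupType).
Variables (c : fuchs_gen g0 r -> Gamma0) (phi : {multiplicative Gamma0 -> G}).
Local Notation X := (fuchs_gen g0 r).
Local Notation q := (fun v => phi (c v)).
Variable rels0 : seq (word X).
Hypothesis pres0 : presents (fun _ => True) (enum X) c rels0.
Hypothesis q_surj : forall y : G, exists Y, ev q Y = y.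
Local Notation f := (fun s : sgen g0 r => ev c (schreier_word q s)).
Local Notation gens := (schreier_gens q).
Local Notation reps := (reps q).

Lemma ev_q_rel w : w \in rels0 -> ev q w = 1.
Proof. by move=> wP; rewrite -ev_morph (presents_rel pres0 wP) mult1. Qed.

(** The Reidemeister-Schreier theorem.  Expand a word over the Schreier
    generators that is trivial in Gamma into the generators of Gamma0, derive its
    triviality there, and rewrite every step of the derivation by tau.  As tau
    sees only cosets, each step becomes a step in the new presentation; and tau
    sends the Schreier word of s back to s, up to generators of the tree. *)
Theorem presents_schreier (rels : seq (word (sgen g0 r))) :
  (forall w, w \in rels -> exists K w0,
     [/\ K \in reps, w0 \in rels0 & w = tau q (K ++ w0 ++ winv K)]) ->
  (forall K w0, K \in reps -> w0 \in rels0 ->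
     tau q (K ++ w0 ++ winv K) \in rels) ->
  presents (in_kernel phi) gens f (rels ++ Mrels q gens).
Proof.
move=> relsP Prels; have [_ gen0 rels0O triv0] := pres0.
have wE w : word_over (enum X) w.
  by apply/allP => l _; rewrite mem_enum.
have relsO : all (word_over gens) (rels ++ Mrels q gens).
  rewrite all_cat; apply/andP; split; apply/allP => w.
    by case/relsP=> K [w0 [_ _ ->]]; apply: tau_from_over.
  by case/mapP=> s; rewrite mem_filter => /andP[_ sP] ->; rewrite /= /word_over /= sP.
have Mtriv K : K \in reps -> trivial_in gens (rels ++ Mrels q gens) (tau q K).
  by move=> KP; apply: triv_M (Mgen_rep _ _) => //; apply: tau_from_over.
have qcat1 (p w : word X) : ev q w = 1 -> ev q (p ++ w) = ev q p.
  by move=> w1; rewrite ev_cat w1 mulg1.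
have trivT p w0 : w0 \in rels0 ->
    trivial_in gens (rels ++ Mrels q gens) (tau_from q p w0).
  move=> w0P; rewrite (eq_tau_from (p' := bar q p)) ?ev_bar //.
  have KP := bar_reps q_surj p.
  have := triv_rel gens (rels := rels ++ Mrels q gens).
  move=> /(_ (tau q (bar q p ++ w0 ++ winv (bar q p)))).
  rewrite mem_cat Prels // tau_conj ?ev_q_rel // => /(_ isT) T.
  by apply/(triv_conj _ (u := tau q (bar q p))) => //; apply: tau_from_over.
have trivtau Y p : trivial_in (enum X) rels0 Y ->
    trivial_in gens (rels ++ Mrels q gens) (tau_from q p Y).
  have pair p' l : trivial_in gens (rels ++ Mrels q gens)
      (tau_from q p' [:: l; linv l]).
    have -> : [:: l; linv l] = [:: l] ++ winv [:: l] by [].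
    by rewrite tau_from_cat tau_from_winv; apply/triv_mulV/tau_from_over.
  have q1 w : w \in rels0 -> ev q w = 1 by apply: ev_q_rel.
  have qpair l : ev q [:: l; linv l] = 1.
    by rewrite -(cat1s l) ev_cat ev_linv mulgV.
  elim=> [|u v l _ _|u v l _|u v w w0P _|u v w w0P _]; first exact: Tnil.
  - rewrite !tau_from_cat => T; apply: (triv_context relsO _ _ (pair _ _)).2.
    by rewrite (eq_tau_from (p := _ ++ [:: l; linv l]) (p' := p ++ u)) //; apply/qcat1/qpair.
  - rewrite !tau_from_cat => /(triv_context relsO _ _ (pair _ _)).
    by rewrite (eq_tau_from (p := _ ++ [:: l; linv l]) (p' := p ++ u)) //; apply/qcat1/qpair.
  - rewrite !tau_from_cat => T; apply: (triv_context relsO _ _ (trivT _ _ w0P)).2.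
    by rewrite (eq_tau_from (p := _ ++ w) (p' := p ++ u)) //; apply/qcat1/q1.
  - rewrite !tau_from_cat => /(triv_context relsO _ _ (trivT _ _ w0P)).
    by rewrite (eq_tau_from (p := _ ++ w) (p' := p ++ u)) //; apply/qcat1/q1.
have ev_expand w : ev q (wsubst (schreier_word q) w) = 1.
  rewrite ev_wsubst; elim: w => [|l w IHw]; first by rewrite ev_nil.
  have s1 s : ev q (schreier_word q s) = 1.
    by rewrite /schreier_word ev_cat ev_winv ev_bar // mulgV.
  by rewrite ev_cons IHw !s1 invg1; case: l.2; rewrite mulg1.
split=> //.
- by move=> s _; rewrite /in_kernel ev_morph /schreier_word ev_cat ev_winv
    ev_bar // mulgV.
- move=> h hK; have [Y _ YE] := gen0 h I; exists (tau q Y).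
    exact: tau_from_over.
  by rewrite ev_tau // -ev_morph YE.
move=> w wO; split=> [w1|]; last first.
  apply: ev_triv => w'; rewrite mem_cat => /orP[/relsP[K [w0 [KP w0P ->]]]|].
    rewrite ev_tau //; last first.
      by rewrite !ev_cat ev_winv (ev_q_rel w0P) mul1g mulgV.
    by rewrite !ev_cat ev_winv (presents_rel pres0 w0P) mul1g mulgV.
  case/mapP=> s; rewrite mem_filter => /andP[sM _] ->.
  by rewrite ev_cons ev_nil mulg1 /=; apply: ev_Mgen.
have /(trivtau _ [::]) : trivial_in (enum X) rels0 (wsubst (schreier_word q) w).
  by apply/triv0 => //; rewrite ev_wsubst.
apply: (triv_weq _).1.
elim: w wO {w1} => [|[s b] w IHw]; first by move=> _; apply: weq_refl.
case/andP=> /= sP /IHw wq; rewrite -cat1s wsubst_cat tau_from_cat.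
apply: weq_cat; last first.
  rewrite (eq_tau_from (p' := [::])) //.
  by rewrite cat0s ev_expand ev_nil.
have sw : weq gens (rels ++ Mrels q gens) (tau q (schreier_word q s)) [:: (s, false)].
  rewrite tau_schreier_word //.
  rewrite -[X in weq _ _ _ X]cat0s; apply: weq_cat.
    by apply/weq_nil/Mtriv => //; rewrite -mem_schreier_gens.
  rewrite -[X in weq _ _ _ X]cats0; apply: weq_cat => //.
  by apply/weq_nil/triv_winv/Mtriv => //; apply: bar_reps.
rewrite /wsubst /= cats0; case: b => //.
rewrite -[tau_from _ _ _]/(tau q _) tau_winv; last first.
  by have := ev_expand [:: (s, false)]; rewrite wsubst1.
apply: (weq_winv _ _ _ sw) => //; first exact: tau_from_over.
by rewrite /word_over /= sP.
Qed.
End ReidemeisterSchreier.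

(** * Solving a relator for a generator *)

Section Solve.
Variable T : eqType.
Implicit Types (s : T) (u v w : word T) (gens : seq T) (rels : seq (word T)).

Lemma count_winv s e w : count_mem (s, e) (winv w) = count_mem (s, ~~ e) w.
Proof.
rewrite /winv count_rev count_map; apply: eq_count => -[t b] /=.
by rewrite /linv !xpair_eqE /=; congr (_ && _); case: b e => [] [].
Qed.

Lemma word_over_count gens w : word_over gens w <->
  forall s e, s \notin gens -> count_mem (s, e) w = 0%N.
Proof.
split=> [wO s e sN|w0].
  by apply/count_memPn; apply: contra sN => sw; apply: (allP wO _ sw).
apply/allP => -[s e] sw; apply: contraLR sw => sN /=.
by apply/count_memPn/w0.
Qed.

Lemma word_over_rem gens s w : uniq gens -> word_over gens w ->
  (forall e, count_mem (s, e) w = 0%N) -> word_over (rem s gens) w.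
Proof.
move=> ug wO w0; apply/allP => -[t e] tw /=; rewrite mem_rem_uniq // inE /=.
rewrite (allP wO _ tw) andbT; apply: contraTneq tw => ->.
exact/count_memPn/w0.
Qed.

Lemma split_at (x : T * bool) w : x \in w ->
  w = take (index x w) w ++ x :: drop (index x w).+1 w.
Proof.
by move=> xw; rewrite -[LHS](cat_take_drop (index x w)) (drop_nth x)
  ?index_mem // nth_index.
Qed.

Definition replace s u : T -> word T :=
  fun t => if t == s then u else [:: (t, false)].

Lemma wsubst_flatten (T' : Type) (th : T -> word T') (ws : seq (word T)) :
  flatten [seq wsubst th w | w <- ws] = wsubst th (flatten ws).
Proof. by elim: ws => //= w ws ->; rewrite wsubst_cat. Qed.

Lemma count_replace s u s' e w : s' != s ->
  count_mem (s', e) (wsubst (replace s u) w) =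
  (count_mem (s', e) w + count_mem (s, false) w * count_mem (s', e) u
   + count_mem (s, true) w * count_mem (s', ~~ e) u)%N.
Proof.
move=> s's; elim: w => //= -[t b] w IHw; rewrite -(cat1s (t, b)) wsubst_cat.
rewrite count_cat IHw {IHw} /wsubst /= cats0 /replace !xpair_eqE.
have [->|ts] := eqVneq t s.
  rewrite [s == s']eq_sym (negPf s's) /= !add0n.
  by case: b; rewrite ?count_winv /= ?add0n ?add1n ?mulSn; lia.
rewrite /= !add0n; case: b; rewrite /= xpair_eqE addn0 -!addnA;
  by case: (t == s'); case: e.
Qed.

Lemma replace_id s u w : (forall b, count_mem (s, b) w = 0%N) ->
  wsubst (replace s u) w = w.
Proof.
move=> w0; apply: wsubst_id => t /mapP[[t' b] /= tw ->]; rewrite /replace.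
case: eqP tw => // -> tw; have /count_memPn := w0 b; by rewrite tw.
Qed.

Lemma replace_over gens s u w : uniq gens -> word_over (rem s gens) u ->
  word_over gens w -> word_over (rem s gens) (wsubst (replace s u) w).
Proof.
move=> ug uO; apply: word_over_wsubst => t tP; rewrite /replace.
by case: eqVneq => // ts; rewrite /word_over /= mem_rem_uniq // inE ts tP.
Qed.

Lemma ev_replace (H : groupType) (f : T -> H) s u w : ev f u = f s ->
  ev f (wsubst (replace s u) w) = ev f w.
Proof.
move=> uE; rewrite ev_wsubst; apply: eq_ev => t; rewrite /replace.
by case: eqP => [->//|_]; rewrite ev_cons ev_nil mulg1.
Qed.

(** A relator becomes freely trivial once its solution for s is substituted.
    Both signs of the letter are needed: gluing solves for either. *)
Lemma triv_solved gens rels s b V1 V2 :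
  let V := V1 ++ (s, b) :: V2 in
  let u := if b then V2 ++ V1 else winv (V2 ++ V1) in
  all (word_over gens) rels -> word_over gens (V2 ++ V1) ->
  (forall e, count_mem (s, e) (V2 ++ V1) = 0%N) ->
  trivial_in gens rels (wsubst (replace s u) V).
Proof.
move=> V u rO VO V0; rewrite /V -cat1s !wsubst_cat.
have [V10 V20] : (forall e, count_mem (s, e) V1 = 0%N)
    /\ (forall e, count_mem (s, e) V2 = 0%N).
  by split=> e; have /eqP := V0 e; rewrite count_cat addn_eq0 => /andP[/eqP + /eqP].
rewrite !(replace_id _ V10) !(replace_id _ V20) /wsubst /= /replace eqxx cats0.
move: VO; rewrite word_over_cat => /andP[V2O V1O].
have -> : (if b then winv u else u) = winv V1 ++ winv V2.
  by rewrite /u; case: b {V u}; rewrite winv_cat.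
by rewrite -catA catA; apply: (triv_cat rO); [exact: triv_mulV|exact: triv_Vmul].
Qed.

Section Presents.
Variables (H : groupType) (L : H -> Prop) (f : T -> H).

Lemma ev_solved s b V1 V2 : ev f (V1 ++ (s, b) :: V2) = 1 ->
  ev f (if b then V2 ++ V1 else winv (V2 ++ V1)) = f s.
Proof.
rewrite -cat1s !ev_cat ev_cons ev_nil mulg1; case: b => /= V1E.
  rewrite ev_cat; move/(congr1 (fun x => (ev f V1)^-1 * x * ev f V1)): V1E.
  rewrite !mulgA mulVg mul1g mulg1 mulVg => /(congr1 (mulg (f s))).
  by rewrite !mulgA mulgV mul1g mulg1.
rewrite ev_winv ev_cat invMg; move/(congr1 (fun x => (ev f V1)^-1 * x * (ev f V2)^-1)): V1E.
by rewrite !mulgA mulVg mul1g mulgK mulg1 => ->.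
Qed.

Lemma presents_solve gens rels s u rels' :
  presents L gens f rels -> uniq gens ->
  word_over (rem s gens) u -> ev f u = f s ->
  all (word_over (rem s gens)) rels' ->
  (forall w, w \in rels' -> ev f w = 1) ->
  (forall w, w \in rels ->
    trivial_in (rem s gens) rels' (wsubst (replace s u) w)) ->
  presents L (rem s gens) f rels'.
Proof.
move=> presL ug uO uE rO r1 rT; apply: presents_elim presL _ rO _ _ r1 rT => t.
- exact: mem_rem.
- move=> tP; rewrite /replace; case: eqVneq => [->//|ts].
  by rewrite /word_over /= mem_rem_uniq // inE ts tP ev_cons ev_nil mulg1.
rewrite mem_rem_uniq // inE /replace => /andP[/negPf -> _] //.
Qed.
End Presents.
End Solve.

(** * Integral cochains *)

(** Pairing of the 1-cochain psi with the chain of edges of w: the homomorphism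
    to the integers that takes the value psi s on s. *)
Definition wt (T : Type) (psi : T -> int) (w : word T) : int :=
  (\sum_(l <- w) (if l.2 then - psi l.1 else psi l.1))%R.

Section Weight.
Variable T : eqType.
Implicit Types (psi : T -> int) (s : T) (u v w : word T).
Import GRing.Theory.

Lemma wt_nil psi : wt psi [::] = 0%R. Proof. exact: big_nil. Qed.

Lemma wt0 w : wt (fun=> 0%R) w = 0%R.
Proof. by rewrite /wt big1 // => l _; rewrite oppr0 if_same. Qed.

Lemma wt_cat psi u v : wt psi (u ++ v) = (wt psi u + wt psi v)%R.
Proof. exact: big_cat. Qed.

Lemma wt1 psi s b : wt psi [:: (s, b)] = (if b then - psi s else psi s)%R.
Proof. exact: big_seq1. Qed.

Lemma wt_winv psi w : wt psi (winv w) = (- wt psi w)%R.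
Proof.
elim: w => [|[s b] w IHw]; first by rewrite wt_nil oppr0.
rewrite winv_cons -cats1 -(cat1s (s, b)) !wt_cat IHw opprD addrC !wt1.
by case: b => //=; rewrite opprK.
Qed.

Lemma wt_replace psi s u w : wt psi u = psi s ->
  wt psi (wsubst (replace s u) w) = wt psi w.
Proof.
move=> uE; elim: w => // -[t b] w IHw; rewrite -(cat1s (t, b)) wsubst_cat.
rewrite !wt_cat IHw; congr (_ + _)%R; rewrite /wsubst /= wt_nil addr0 wt1 /replace.
by case: eqP => [->|_]; case: b; rewrite ?wt_winv ?uE ?wt1.
Qed.

Definition dirac s : T -> int := fun t => (t == s)%:R%R.

Lemma wt_dirac s w :
  (wt (dirac s) w = (count_mem (s, false) w)%:Z - (count_mem (s, true) w)%:Z)%R.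
Proof.
elim: w => [|[t b] w IHw]; first by rewrite wt_nil.
rewrite -cat1s wt_cat IHw wt1 /dirac !count_cat /= !xpair_eqE.
by case: b; case: (t == s); rewrite /=; lia.
Qed.

Lemma wt_expand gs psi w : uniq gs -> word_over gs w ->
  (wt psi w = \sum_(s <- gs) psi s * wt (dirac s) w)%R.
Proof.
move=> ug; elim: w => [|[t b] w IHw] /=.
  by move=> _; rewrite wt_nil big1 // => s _; rewrite wt_nil mulr0.
case/andP=> /= tg /IHw wE; rewrite -cat1s wt_cat wE.
under [in RHS]eq_bigr do rewrite wt_cat mulrDr.
rewrite big_split /=; congr (_ + _)%R; rewrite (bigD1_seq t) //= big1 => [|s ts].
  by rewrite !wt1 /dirac eqxx addr0; case: b; rewrite ?mulr1 ?mulrN1.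
by rewrite wt1 /dirac eq_sym (negPf ts); case: b; rewrite ?oppr0 mulr0.
Qed.

Lemma wtB psi1 psi2 w :
  (wt (fun s => psi1 s - psi2 s) w = wt psi1 w - wt psi2 w)%R.
Proof.
elim: w => [|[t b] w IHw]; first by rewrite !wt_nil subr0.
by rewrite -cat1s !wt_cat IHw !wt1; case: b; rewrite /=; lia.
Qed.
End Weight.

(** * Elliptic elimination *)

Lemma subst_genE g0 r (s : sgen g0 r) u w :
  subst_gen s u w = wsubst (replace s u) w.
Proof.
rewrite /subst_gen /wsubst /replace; congr flatten; apply: eq_map => -[t b] /=.
by case: (t == s) => //; case: b.
Qed.

Section EllipticRelations.
Variables (g0 r : nat) (G : finGroupType) (q : fuchs_gen g0 r -> G).
Variable m : 'I_r -> nat.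
Hypothesis q_surj : forall y : G, exists Y, ev q Y = y.
Hypothesis q_order : forall i, #[q (gx g0 i)] = m i.
Local Notation X := (fuchs_gen g0 r).
Local Notation bar := (bar q).
Local Notation reps := (reps q).
Local Notation gens := (schreier_gens q).
Local Notation Mgen := (Mgen q).
Local Notation ell := (elliptic_relation m q).
Implicit Types (u v w K Y p B : word X) (s : sgen g0 r) (i : 'I_r).

Definition xpow i j : word X := nseq j (gx g0 i, false).

Lemma ev_xpow i j : ev q (xpow i j) = q (gx g0 i) ^+ j.
Proof.
by elim: j => [|j IHj]; rewrite ?ev_nil //= ev_cons IHj expgS.
Qed.

Lemma ev_elliptic_rel i : ev q (elliptic_rel g0 m i) = 1.
Proof. by rewrite [LHS]ev_xpow -q_order expg_order. Qed.

Lemma tau_from_xpow K i j :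
  tau_from q K (xpow i j) =
  [seq ((bar (K ++ xpow i k), gx g0 i), false) | k <- iota 0 j].
Proof.
elim: j K => // j IHj K; rewrite /= IHj cats0; congr (_ :: _).
rewrite -[1%N]addn0 iotaDl -map_comp; apply: eq_map => k /=.
by rewrite cat_rcons.
Qed.

(** The edges of the elliptic disc of K: its vertices form an orbit of right
    multiplication by x_i. *)
Definition on_orbit i K s :=
  (s.2 == gx g0 i) && (ev q s.1 \in ev q K *: <[q (gx g0 i)]>).

(** The cosets K x_i^j with j < m_i are distinct, since m_i is the order of x_i
    in G. *)
Lemma count_orbit i K s e : s.1 \in reps ->
  count_mem (s, e) (tau_from q K (elliptic_rel g0 m i)) = ~~ e && on_orbit i K s :> nat.
Proof.
move=> sP; rewrite [elliptic_rel _ _ _]/(xpow i (m i)) tau_from_xpow.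
rewrite count_map -[LHS]/(count _ _).
have inj : {in iota 0 (m i) &, injective (fun k => (bar (K ++ xpow i k)))}.
  move=> j k; rewrite !mem_iota /= => jm km /(congr1 (ev q)).
  rewrite !ev_bar // !ev_cat => /mulgI; rewrite !ev_xpow => /eqP.
  by rewrite eq_expg_mod_order q_order !modn_small // => /eqP.
transitivity (count_mem (s, e) [seq ((bar (K ++ xpow i k), gx g0 i), false) | k <- iota 0 (m i)]).
  by rewrite count_map.
rewrite count_uniq_mem; last first.
  by rewrite map_inj_in_uniq ?iota_uniq // => j k jP kP [] /inj; exact.
congr nat_of_bool; apply/mapP/andP => [[k _ [-> ->]]|].
  rewrite /on_orbit eqxx ev_bar // ev_cat ev_xpow mem_lcoset mulKg.
  by rewrite mem_cycle.
case: e => -[] // _ /andP[/eqP s2]; rewrite mem_lcoset => /cyclePmin[k].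
rewrite q_order => km kE; exists k; first by rewrite mem_iota.
case: s sP s2 kE => B x /= BP -> kE; congr (_, _, _).
apply: reps_inj BP (bar_reps q_surj _) _.
by rewrite ev_bar // ev_cat ev_xpow -kE mulVKg.
Qed.

Lemma count_M s e (w : word (sgen g0 r)) : ~~ Mgen s -> all (fun t => Mgen t.1) w ->
  count_mem (s, e) w = 0%N.
Proof.
by move=> sM wM; apply/count_memPn; apply: contra sM => /(allP wM).
Qed.

Lemma count_conj K s e : K \in reps -> ~~ Mgen s ->
  forall Y, ev q Y = 1 ->
  count_mem (s, e) (tau q (K ++ Y ++ winv K)) = count_mem (s, e) (tau_from q K Y).
Proof.
move=> KP sM Y Y1; rewrite tau_conj // !count_cat count_winv.
have K0 b : count_mem (s, b) (tau q K) = 0%N by apply/count_M/Mgen_rep.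
by rewrite !K0 addn0.
Qed.

Lemma count_ell i K s e : K \in reps -> s.1 \in reps -> ~~ Mgen s ->
  count_mem (s, e) (ell i K) = ~~ e && on_orbit i K s :> nat.
Proof.
by move=> KP sP sM; rewrite count_conj ?count_orbit // ev_elliptic_rel.
Qed.

Lemma ell_split i K s : (s, false) \in ell i K -> exists V1 V2,
  ell i K = V1 ++ (s, false) :: V2 /\ solve_for s (ell i K) = winv (V2 ++ V1).
Proof.
rewrite /solve_for; move: (ell i K) => w sw.
exists (take (index (s, false) w) w), (drop (index (s, false) w).+1 w).
by split=> //; apply: split_at.
Qed.

(** Each generator of an orbit occurs once in its relation, so the solution for
    s is a product of the inverses of the other ones. *)
Lemma count_solve i K s s' e : K \in reps -> s.1 \in reps -> ~~ Mgen s ->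
  on_orbit i K s -> s'.1 \in reps -> ~~ Mgen s' ->
  count_mem (s', e) (solve_for s (ell i K)) =
  [&& e, s' != s & on_orbit i K s'] :> nat.
Proof.
move=> KP sP sM sO s'P s'M.
have sell : (s, false) \in ell i K.
  by rewrite -has_pred1 has_count count_ell // sO.
have [V1 [V2 [VE ->]]] := ell_split sell.
have := count_ell i (~~ e) KP s'P s'M; rewrite VE count_winv !count_cat /=.
rewrite xpair_eqE negbK [s == s']eq_sym.
have [s's|_] := eqVneq s' s; rewrite ?s's ?sO; first by case: e => /=; lia.
by rewrite /= add0n addnC => ->.
Qed.
End EllipticRelations.

Section EllipticElimination.
Variables (g0 r : nat) (G : finGroupType) (q : fuchs_gen g0 r -> G).
Variable m : 'I_r -> nat.
Hypothesis q_surj : forall y : G, exists Y, ev q Y = y.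
Hypothesis q_order : forall i, #[q (gx g0 i)] = m i.
Local Notation X := (fuchs_gen g0 r).
Local Notation reps := (reps q).
Local Notation gens := (schreier_gens q).
Local Notation Mgen := (Mgen q).
Local Notation ell := (elliptic_relation m q).
Local Notation choice := ('I_r * (word X * sgen g0 r))%type.
Implicit Types (K Y : word X) (s : sgen g0 r) (i : 'I_r).
Implicit Types (it : choice) (L : seq choice).

Definition target it : sgen g0 r := it.2.2.
Definition ell_of it := ell it.1 it.2.1.
Definition solution it := solve_for (target it) (ell_of it).
Definition owns it s := on_orbit q it.1 it.2.1 s.

Definition choices (e : 'I_r -> seq (word X * sgen g0 r)) : seq choice :=
  flatten [seq [seq (i, t) | t <- e i] | i <- enum 'I_r].

Definition eliminate it (P : seq (sgen g0 r) * seq (word (sgen g0 r))) :=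
  (rem (target it) P.1, [seq wsubst (replace (target it) (solution it)) w | w <- P.2]).

Definition eliminate_all L P := foldl (fun P it => eliminate it P) P L.

Lemma elliptic_elimE e P :
  elliptic_elim m q e P = eliminate_all (choices e) P.
Proof.
rewrite /elliptic_elim /choices; elim: (enum _) P => //= i s IHs P.
rewrite IHs /eliminate_all foldl_cat; congr foldl.
elim: (e i) P => //= t ts IHt P; rewrite IHt; congr foldl.
rewrite /elliptic_step /eliminate; congr (_, _); apply: eq_map => w.
exact: subst_genE.
Qed.

(** The orbits treated in L are pairwise distinct, which is what makes the
    eliminations independent of each other. *)
Definition independent L :=
  (forall it, it \in L -> [/\ it.2.1 \in reps, (target it).1 \in reps,
     ~~ Mgen (target it) & owns it (target it)]) /\
  (forall s, count (owns^~ s) L <= 1)%N.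

Lemma mem_choices e it : (it \in choices e) = (it.2 \in e it.1).
Proof.
apply/flatten_mapP/idP => [[i _ /mapP[t te ->]]//|te].
exists it.1; first by rewrite mem_enum.
by apply/mapP; exists it.2 => //; case: (it).
Qed.

Lemma count_owns e s : elliptic_choice m q e -> s.1 \in reps ->
  count (owns^~ s) (choices e) = (if s.2 is inl _ then 1%N else 0%N).
Proof.
move=> eP sP; rewrite /choices count_flatten -map_comp.
have countE i : count (owns^~ s) [seq (i, t) | t <- e i] = (s.2 == gx g0 i) :> nat.
  rewrite count_map; have [_ /(_ s.1 sP) e1 _] := eP i.
  have [s2|s2] := eqVneq s.2 (gx g0 i); last first.
    apply/eqP; rewrite -leqn0 leqNgt -has_count; apply/hasPn => t _ /=.
    by rewrite /owns /on_orbit (negPf s2).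
  rewrite -[RHS]/1%N -e1; apply: eq_count => t /=.
  by rewrite /owns /on_orbit s2 eqxx /= lcoset_sym.
rewrite (eq_map (g := fun i => (s.2 == gx g0 i) : nat)) //.
case s2 : s.2 => [i|x]; last by rewrite sumnE big_map big1.
rewrite sumnE big_map big_enum /= (bigD1 i) //= eqxx big1 // => j ji.
by rewrite /gx /= -[_ == _]/(i == j) eq_sym (negPf ji).
Qed.

Lemma independent_choices e :
  elliptic_choice m q e -> independent (choices e).
Proof.
move=> eP; split=> [[i t]|s].
  rewrite mem_choices /= => te; have [repsP _ /(_ t te)[tell tM]] := eP i.
  have KP : t.1 \in reps by apply/repsP/map_f.
  have tP : (target (i, t)).1 \in reps.
    rewrite -mem_schreier_gens.
    have /allP : word_over gens (ell i t.1) by apply: tau_from_over.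
    by move/(_ _ tell).
  split=> //; have := count_ell q_surj q_order i false KP tP tM.
  rewrite /= /owns /=; case: on_orbit => // /eqP.
  by rewrite -leqn0 leqNgt -has_count has_pred1 tell.
rewrite (eq_count (a2 := owns^~ (bar q s.1, s.2))); last first.
  by move=> t; rewrite /owns /on_orbit /= ev_bar.
by rewrite count_owns //= ?bar_reps //; case: s.2.
Qed.

Lemma independent_cons it L : independent (it :: L) ->
  [/\ independent L, [/\ it.2.1 \in reps, (target it).1 \in reps,
     ~~ Mgen (target it) & owns it (target it)]
   & forall it', it' \in L -> [/\ ~~ owns it (target it'),
       ~~ owns it' (target it) & target it' != target it]].
Proof.
case=> LP L1; have itP := LP it (mem_head _ _); split=> //.
  split=> [it' it'L|s]; first by apply: LP; rewrite inE it'L orbT.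
  exact: leq_trans (leq_addl _ _) (L1 s).
move=> it' it'L; have [_ _ _ own'] := LP it' (mem_behead (s := it :: L) it'L).
have [_ _ _ own] := itP.
have N1 : ~~ owns it (target it').
  apply/negP => o; have := L1 (target it'); rewrite /= o add1n ltnS leqNgt.
  by rewrite -has_count => /hasPn/(_ it' it'L)/negP.
split=> //; last by apply: contraNneq N1 => ->.
have := L1 (target it); rewrite /= own add1n ltnS leqNgt -has_count.
by move/hasPn/(_ it' it'L).
Qed.

Lemma solution_spec it : it.2.1 \in reps -> (target it).1 \in reps ->
  ~~ Mgen (target it) -> owns it (target it) -> exists V1 V2,
  ell_of it = V1 ++ (target it, false) :: V2 /\ solution it = winv (V2 ++ V1).
Proof.
move=> KP sP sM sO; apply: ell_split.
by rewrite -has_pred1 has_count count_ell //= -[on_orbit _ _ _ _]/(owns it (target it)) sO.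
Qed.

Lemma count_solution it s e : it.2.1 \in reps -> (target it).1 \in reps ->
  ~~ Mgen (target it) -> owns it (target it) -> s.1 \in reps -> ~~ Mgen s ->
  count_mem (s, e) (solution it) = [&& e, s != target it & owns it s] :> nat.
Proof. by move=> *; apply: count_solve. Qed.

Lemma uniq_eliminate_all L P : uniq P.1 -> uniq (eliminate_all L P).1.
Proof. by elim: L P => //= it L IHL P uP; apply/IHL/rem_uniq. Qed.

Lemma mem_eliminate_all L P s : uniq P.1 ->
  (s \in (eliminate_all L P).1) = (s \in P.1) && (s \notin map target L).
Proof.
elim: L P => [|it L IHL] P /= uP; first by rewrite andbT.
rewrite IHL ?rem_uniq // mem_rem_uniq // !inE negb_or.
by case: eqP => //=; rewrite ?andbF.
Qed.

(** In place of its eliminated generator an orbit contributes one inverse letter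
    for each of the other ones. *)
Lemma count_eliminate_all L P s e : independent L ->
  (forall it, it \in L -> count_mem (target it, false) (flatten P.2) = 1%N /\
     count_mem (target it, true) (flatten P.2) = 0%N) ->
  s.1 \in reps -> ~~ Mgen s -> s \notin map target L ->
  count_mem (s, e) (flatten (eliminate_all L P).2) =
  (count_mem (s, e) (flatten P.2) + e * count (owns^~ s) L)%N.
Proof.
elim: L P => [|it L IHL] P; first by rewrite /= muln0 addn0.
case/independent_cons=> indL [KP tP tM tO] LP Pcount sP sM.
rewrite inE negb_or => /andP[st sL] /=.
have cnt s' e' : s'.1 \in reps -> ~~ Mgen s' -> s' != target it ->
    count_mem (s', e') (flatten (eliminate it P).2) =
    (count_mem (s', e') (flatten P.2) + e' * owns it s')%N.
  move=> s'P s'M s't; rewrite /= wsubst_flatten count_replace //.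
  have [-> ->] := Pcount it (mem_head _ _).
  rewrite mul0n addn0 mul1n count_solution // s't /=.
  by case: e'; rewrite ?mul1n.
rewrite IHL // => [|it' it'L]; last first.
  have [itt' it't tt] := LP it' it'L; have [_ t'P t'M _] := indL.1 it' it'L.
  rewrite !cnt // (negPf itt') !muln0 !addn0.
  by apply: Pcount; rewrite inE it'L orbT.
by rewrite cnt // mulnDr addnA.
Qed.

(** A cochain that vanishes on the elliptic discs does not see the substitution
    of the solutions of their relations. *)
Lemma wt_eliminate_all psi L P : independent L ->
  (forall it, it \in L -> wt psi (ell_of it) = 0%R) ->
  map (wt psi) (eliminate_all L P).2 = map (wt psi) P.2.
Proof.
elim: L P => //= it L IHL P /independent_cons[indL [KP tP tM tO] _] psi0.
rewrite IHL // => [|it' it'L]; last by rewrite psi0 // inE it'L orbT.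
rewrite /= -map_comp; apply: eq_map => w /=; apply: wt_replace.
have [V1 [V2 [VE ->]]] := solution_spec KP tP tM tO.
have := psi0 it (mem_head _ _); rewrite VE -cat1s !wt_cat wt1 wt_winv wt_cat.
by move=> /= V0; lia.
Qed.

Section Presents.
Variables (Gamma0 : groupType) (L0 : Gamma0 -> Prop) (f : sgen g0 r -> Gamma0).

Lemma Mrels_over (gs : seq (sgen g0 r)) : all (word_over gs) (Mrels q gs).
Proof.
apply/allP => w /mapP[s]; rewrite mem_filter => /andP[_ sP] ->.
by rewrite /word_over /= sP.
Qed.

Lemma mem_Mrels (gs : seq (sgen g0 r)) s :
  s \in gs -> Mgen s -> [:: (s, false)] \in Mrels q gs.
Proof. by move=> sP sM; apply: map_f; rewrite mem_filter sM. Qed.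

(** The relators of the orbits still to be treated are carried along in the
    presentation; they do not mention the generator eliminated now, because no
    orbit is treated twice. *)
Lemma presents_eliminate_all L P : independent L -> uniq P.1 ->
  {subset P.1 <= gens} ->
  presents L0 P.1 f (P.2 ++ Mrels q P.1 ++ [seq ell_of it | it <- L]) ->
  presents L0 (eliminate_all L P).1 f
    ((eliminate_all L P).2 ++ Mrels q (eliminate_all L P).1).
Proof.
elim: L P => [|it L IHL] P; first by rewrite /= cats0.
case/independent_cons=> indL [KP tP tM tO] LP uP Pg presP /=.
apply: IHL => //=; [exact: rem_uniq|by move=> s /mem_rem/Pg|].
set s := target it in tP tM tO LP *; set u := solution it.
have [V1 [V2 [VE uE]]] := solution_spec KP tP tM tO.
have rel1 w := presents_rel (w := w) presP.
have [_ _ relsO _] := presP.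
have ellP : ell_of it \in P.2 ++ Mrels q P.1 ++ [seq ell_of it | it <- it :: L].
  by rewrite !mem_cat mem_head !orbT.
have VO := allP relsO _ ellP.
have V0 e : count_mem (s, e) (V2 ++ V1) = 0%N.
  have := count_ell q_surj q_order it.1 e KP tP tM.
  rewrite -/(ell_of it) VE [on_orbit _ _ _ _]tO !count_cat /= xpair_eqE eqxx /=.
  by case: e => /=; lia.
have VV : word_over P.1 (V2 ++ V1).
  move: VO; rewrite VE -cat1s !word_over_cat => /and3P[V1O _ V2O].
  by rewrite V2O V1O.
have uO : word_over (rem s P.1) u.
  by rewrite /u uE word_over_winv; apply: word_over_rem.
have uf : ev f u = f s.
  by rewrite /u uE; apply: (ev_solved (b := false)); rewrite -VE rel1.
have ell0 it' : it' \in L -> forall e, count_mem (s, e) (ell_of it') = 0%N.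
  move=> it'L e; have [_ /negPf ot' _] := LP it' it'L.
  have [K'P _ _ _] := indL.1 it' it'L.
  by rewrite count_ell // -[on_orbit _ _ _ _]/(owns it' s) ot' andbF.
have newO : all (word_over (rem s P.1))
   ([seq wsubst (replace s u) w | w <- P.2] ++ Mrels q (rem s P.1)
    ++ [seq ell_of it0 | it0 <- L]).
  rewrite !all_cat Mrels_over /=; apply/andP; split; apply/allP => w.
    case/mapP=> w' w'P ->; apply: replace_over => //.
    by apply: (allP relsO); rewrite mem_cat w'P.
  case/mapP=> it' it'L ->; apply: word_over_rem => //; last exact: ell0.
  by apply: (allP relsO); rewrite !mem_cat inE map_f ?orbT.
apply: (presents_solve presP uP uO uf newO) => w.
  rewrite !mem_cat => /or3P[/mapP[w' w'P ->]|/mapP[t]|/mapP[it' it'L ->]].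
  - by rewrite ev_replace // rel1 // mem_cat w'P.
  - rewrite mem_filter => /andP[Mt /mem_rem tg] ->; apply: rel1.
    by rewrite !mem_cat mem_Mrels ?orbT.
  - by apply: rel1; rewrite !mem_cat inE map_f ?orbT.
rewrite !mem_cat inE => /or3P[wP|/mapP[t]|/predU1P[->|/mapP[it' it'L ->]]].
- by apply: triv_rel; rewrite mem_cat map_f.
- rewrite mem_filter => /andP[Mt tg] ->; rewrite wsubst1 /replace.
  case: eqVneq => [ts|ts]; first by rewrite -ts Mt in tM.
  by apply: triv_rel; rewrite !mem_cat mem_Mrels ?orbT // mem_rem_uniq // inE ts.
- have := triv_solved false newO (word_over_rem uP VV V0) V0.
  by rewrite /= -uE -VE.
rewrite replace_id; last exact: ell0.
by apply: triv_rel; rewrite !mem_cat map_f ?orbT.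
Qed.
End Presents.
End EllipticElimination.

(** * The faces of the coset complex *)

Section SurfaceRelation.
Variables (g0 r : nat).
Local Notation X := (fuchs_gen g0 r).

Definition handle (i : 'I_g0) : word X :=
  [:: (ga r i, false); (gb r i, false); (ga r i, true); (gb r i, true)].

Lemma surface_relE : surface_rel g0 r =
  flatten [seq handle i | i <- enum 'I_g0] ++ [seq (gx g0 i, false) | i <- enum 'I_r].
Proof. by []. Qed.

Lemma count_surface_rel (x : X) e :
  count_mem (x, e) (surface_rel g0 r) =
  nat_of_bool (if x is inl _ then ~~ e else true).
Proof.
rewrite surface_relE count_cat count_flatten -map_comp sumnE big_map.
have -> : count_mem (x, e) [seq (gx g0 i, false) | i <- enum 'I_r] =
    nat_of_bool (if x is inl _ then ~~ e else false).
  rewrite count_uniq_mem; last first.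
    by rewrite map_inj_uniq ?enum_uniq // => i j [].
  congr nat_of_bool; apply/mapP/idP => [[i _ [-> ->]]//|].
  by case: x => // i; case: e => // _; exists i; rewrite ?mem_enum.
rewrite big_enum /=; case: x => [i|[i|i]].
- by rewrite big1 // => j _; rewrite /handle /= !xpair_eqE.
- have E (j k : 'I_g0) : (inr (inl j) == inr (inl k) :> X) = (j == k) by [].
  rewrite (bigD1 i) //= big1 ?addn0 => [|j ji]; rewrite !xpair_eqE /= !E.
    by rewrite eqxx; case: e.
  by rewrite (negPf ji).
- have E (j k : 'I_g0) : (inr (inr j) == inr (inr k) :> X) = (j == k) by [].
  rewrite (bigD1 i) //= big1 ?addn0 => [|j ji]; rewrite !xpair_eqE /= !E.
    by rewrite eqxx; case: e.
  by rewrite (negPf ji).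
Qed.
End SurfaceRelation.

Section Faces.
Variables (g0 r : nat) (G : finGroupType) (q : fuchs_gen g0 r -> G).
Hypothesis q_surj : forall y : G, exists Y, ev q Y = y.
Local Notation X := (fuchs_gen g0 r).
Local Notation reps := (reps q).
Local Notation gens := (schreier_gens q).
Local Notation Mgen := (Mgen q).
Local Notation bar := (bar q).
Implicit Types (K Y p : word X) (s : sgen g0 r) (x : X).

Lemma big_reps (R : Type) (idx : R) (op : SemiGroup.com_law R) (F : G -> R) :
  \big[op/idx]_(K <- reps) F (ev q K) = \big[op/idx]_(y : G) F y.
Proof.
rewrite -(big_map (ev q) xpredT F) (perm_big _ (perm_reps q_surj)).
exact: big_enum.
Qed.

Lemma bar_eq_rep K p B : B \in reps ->
  (bar (K ++ p) == B) = (ev q K == ev q B * (ev q p)^-1).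
Proof.
move=> BP; apply/eqP/eqP => [<-|KE]; first by rewrite ev_bar // ev_cat mulgK.
apply: reps_inj (bar_reps q_surj _) BP _.
by rewrite ev_bar // ev_cat KE mulgVK.
Qed.

(** For each position in Y, the coset from which its letter is read runs through
    all of G as K runs through the representatives, and meets that of s once. *)
Lemma count_faces p Y s e : s.1 \in reps ->
  (\sum_(K <- reps) count_mem (s, e) (tau_from q (K ++ p) Y))%N =
  count_mem (s.2, e) Y.
Proof.
move=> sP; elim: Y p => [|[x b] Y IHY] p; first by rewrite big1.
rewrite /= big_split /= -(IHY (rcons p (x, b))); congr (_ + _)%N; last first.
  by apply: eq_bigr => K _; rewrite rcons_cat.
pose p' := if b then rcons p (x, true) else p.
transitivity (\sum_(K <- reps) ((ev q K == ev q s.1 * (ev q p')^-1)%g &&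
    ((x, b) == (s.2, e))))%N.
  apply: eq_bigr => K _; rewrite -bar_eq_rep // !xpair_eqE {}/p'.
  by clear IHY; case: s sP => B x' _ /=; case: b; rewrite ?rcons_cat xpair_eqE andbA.
rewrite (big_reps _ _ (fun y => (y == _) && _ : nat)) (bigD1 (ev q s.1 * (ev q p')^-1)) //=.
by rewrite eqxx big1 ?addn0 // => y /negPf ->.
Qed.

Local Notation R := (surface_rel g0 r).
Hypothesis ev_R : ev q R = 1.

Lemma count_R_relations s e : s.1 \in reps -> ~~ Mgen s ->
  count_mem (s, e) (flatten (R_relations q)) = count_mem (s.2, e) R.
Proof.
move=> sP sM; rewrite -(count_faces [::] R e sP) count_flatten -map_comp.
rewrite sumnE big_map big_seq [in RHS]big_seq; apply: eq_bigr => K KP.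
by rewrite /= cats0 count_conj.
Qed.

(** The coefficient of the edge (y, x) in the boundary of the chain of faces in
    which the face at h has multiplicity chi h: an occurrence of x in Y that is
    read after the prefix p contributes the face at y p^-1, and one of x^-1
    contributes, with a minus sign, the face at y (p x^-1)^-1. *)
Fixpoint edge_sum (chi : G -> int) (y : G) x (p : G) Y : int :=
  if Y is (x', b) :: Y' then
    ((if x' == x then
        if b then - chi (y * (p * (q x')^-1)^-1)%g else chi (y * p^-1)%g
      else 0) + edge_sum chi y x (p * (if b then (q x')^-1 else q x'))%g Y')%R
  else 0%R.


Lemma sum_faces chi s p Y : s.1 \in reps ->
  (\sum_(K <- reps) chi (ev q K) * wt (dirac s) (tau_from q (K ++ p) Y))%R =
  edge_sum chi (ev q s.1) s.2 (ev q p) Y.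
Proof.
move=> sP; elim: Y p => [|[x b] Y IHY] p.
  by rewrite big1 // => K _; rewrite wt_nil GRing.mulr0.
have E : ev q p * (if b then (q x)^-1 else q x) = ev q (rcons p (x, b)).
  by rewrite ev_rcons ev_cons ev_nil mulg1.
rewrite /= {}E.
rewrite -IHY; pose p' := if b then rcons p (x, true) else p.
under eq_bigr => K _ do rewrite -cat1s wt_cat GRing.mulrDr rcons_cat.
rewrite big_split /=; congr (_ + _)%R; last first.
  by apply: eq_bigr => K _; rewrite rcons_cat.
rewrite -[RHS]/(if x == s.2 then _ else _).
transitivity (\sum_(K <- reps) chi (ev q K) * (((ev q K == ev q s.1 * (ev q p')^-1)%g
     && (x == s.2))%:R * (-1) ^+ b))%R.
  apply: eq_bigr => K _; rewrite wt1 /dirac; congr (_ * _)%R.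
  rewrite -bar_eq_rep // {}/p'.
  by clear IHY; case: s sP => B x' _ /=; case: b; rewrite ?rcons_cat xpair_eqE
    ?GRing.expr1 ?GRing.expr0 ?GRing.mulr1 ?GRing.mulrN1.
rewrite (big_reps _ _ (fun y => chi y * (((y == _) && _)%:R * _))%R).
rewrite (bigD1 (ev q s.1 * (ev q p')^-1)) //= eqxx big1 ?GRing.addr0; last first.
  by move=> y /negPf ->; rewrite GRing.mul0r GRing.mulr0.
case: (x == s.2) => /=; last by rewrite GRing.mul0r GRing.mulr0.
rewrite GRing.mul1r {}/p'; case: b => /=; rewrite ?GRing.expr1 ?GRing.expr0
  ?GRing.mulr1 ?GRing.mulrN1 //.
by rewrite ev_rcons ev_cons ev_nil mulg1.
Qed.

Lemma edge_sum_cat chi y x (p : G) Y Y' : edge_sum chi y x p (Y ++ Y') =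
  (edge_sum chi y x p Y + edge_sum chi y x (p * ev q Y)%g Y')%R.
Proof.
elim: Y p => [|[x' b] Y IHY] p /=; first by rewrite ev_nil mulg1 GRing.add0r.
by rewrite IHY GRing.addrA ev_cons mulgA.
Qed.

Lemma edge_sum0 chi y x (p : G) Y : x \notin map fst Y -> edge_sum chi y x p Y = 0%R.
Proof.
elim: Y p => [|[x' b] Y IHY] p //=; rewrite inE negb_or eq_sym.
by case/andP=> /negPf -> /IHY ->.
Qed.

Section Connectivity.
Variable chi : G -> int.
Definition inv_by u := forall y, chi (y * u) = chi y.

Lemma inv_by1 : inv_by 1. Proof. by move=> y; rewrite mulg1. Qed.
Lemma inv_byM u v : inv_by u -> inv_by v -> inv_by (u * v).
Proof. by move=> iu iv y; rewrite mulgA iv iu. Qed.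
Lemma inv_byV u : inv_by u -> inv_by u^-1.
Proof. by move=> iu y; rewrite -iu mulgVK. Qed.

(** Each edge labelled a or b separates two faces, on which chi must agree.  For
    a this is invariance under a b^-1 a^-1, for b under a b a b^-1 a^-1; together
    they give a b, then a and b. *)
Lemma inv_handle (p : G) i : inv_by p ->
  (forall y, edge_sum chi y (ga r i) p (handle r i) = 0%R) ->
  (forall y, edge_sum chi y (gb r i) p (handle r i) = 0%R) ->
  inv_by (q (ga r i)) /\ inv_by (q (gb r i)).
Proof.
move=> ip; set a := q (ga r i); set b := q (gb r i) => ea eb.
have ipV y : chi (y * p^-1) = chi y by apply: inv_byV.
have ic : inv_by (a * b^-1 * a^-1).
  move=> y; have := ea y; rewrite /= eqxx -/a -/b.
  rewrite !invMg !invgK !GRing.add0r GRing.addr0 !mulgA.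
  by rewrite !ipV => /eqP; rewrite GRing.subr_eq0 => /eqP ->; rewrite -!mulgA.
have iabc : inv_by (a * b * (a * b^-1 * a^-1)).
  move=> y; have := eb (y * a); rewrite /= eqxx -/a -/b.
  rewrite !invMg !invgK !GRing.add0r GRing.addr0 !mulgA mulgK.
  by rewrite !ipV => /eqP; rewrite GRing.subr_eq0 => /eqP ->.
have iab : inv_by (a * b).
  by move=> y; rewrite -[RHS]iabc -[LHS]ic; congr chi; rewrite !mulgA.
have ia : inv_by a.
  have -> : a = a * b^-1 * a^-1 * (a * b) by rewrite !mulgA mulgVK mulgVK.
  exact: inv_byM.
split=> //; have -> : b = a^-1 * (a * b) by rewrite mulKg.
by apply: inv_byM => //; apply: inv_byV.
Qed.

Lemma mem_handles x (js : seq 'I_g0) :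
  x \in map fst (flatten (map (@handle g0 r) js)) ->
  exists2 k, k \in js & x = ga r k \/ x = gb r k.
Proof.
case/mapP=> l /flattenP[_ /mapP[k kjs ->] lk] ->; exists k => //.
by move: lk; rewrite !inE => /or4P[] /eqP ->; [left|right|left|right].
Qed.

(** The prefix at which a handle is read is a product of commutators of earlier
    handles; once chi is known to be invariant under these, it can be ignored. *)
Lemma inv_handles (js : seq 'I_g0) (p : G) : uniq js -> inv_by p ->
  (forall i y, i \in js ->
     edge_sum chi y (ga r i) p (flatten (map (@handle g0 r) js)) = 0%R /\
     edge_sum chi y (gb r i) p (flatten (map (@handle g0 r) js)) = 0%R) ->
  inv_by (p * ev q (flatten (map (@handle g0 r) js))) /\
  forall i, i \in js -> inv_by (q (ga r i)) /\ inv_by (q (gb r i)).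
Proof.
elim: js p => [|j js IHj] p; first by rewrite ev_nil mulg1.
case/andP=> jjs ujs ip eab.
set Z := flatten (map (@handle g0 r) js) in eab *.
have jZ : (ga r j \notin map fst Z) /\ (gb r j \notin map fst Z).
  by split; apply: contra jjs => /mem_handles[k kjs [] // [->]].
have eab1 i y : i \in j :: js ->
    (edge_sum chi y (ga r i) p (handle r j)
     + edge_sum chi y (ga r i) (p * ev q (handle r j))%g Z = 0 /\
    edge_sum chi y (gb r i) p (handle r j)
     + edge_sum chi y (gb r i) (p * ev q (handle r j))%g Z = 0)%R.
  by move=> ijs; rewrite -!edge_sum_cat; apply: eab.
have [ia ib] : inv_by (q (ga r j)) /\ inv_by (q (gb r j)).
  apply: inv_handle (ip) _ _ => y; have [] := eab1 j y (mem_head _ _);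
    rewrite (edge_sum0 _ _ _ jZ.1) (edge_sum0 _ _ _ jZ.2) !GRing.addr0 //.
have iph : inv_by (p * ev q (handle r j)).
  rewrite /handle !ev_cons ev_nil mulg1; apply: inv_byM => //.
  by do ![exact: inv_byV | apply: inv_byM => //].
have [|iZ ijs] := IHj _ ujs iph.
  move=> i y ijs; have ij : i != j by apply: contraNneq jjs => <-.
  have [] := eab1 i y (mem_behead (s := j :: js) ijs).
  rewrite (@edge_sum0 _ _ (ga r i)) 1?(@edge_sum0 _ _ (gb r i)) ?GRing.add0r //.
    by rewrite /handle /= !inE !negb_or; apply/and4P; split=> //; apply: contraNneq ij => -[->].
  by rewrite /handle /= !inE !negb_or; apply/and4P; split=> //; apply: contraNneq ij => -[->].
split; first by rewrite ev_cat mulgA.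
by move=> i; rewrite inE => /predU1P[->|/ijs].
Qed.

Lemma inv_cones (js : seq 'I_r) (p : G) : uniq js -> inv_by p ->
  (forall i y, i \in js ->
     edge_sum chi y (gx g0 i) p [seq (gx g0 k, false) | k <- js] =
     edge_sum chi (y * q (gx g0 i))%g (gx g0 i) p [seq (gx g0 k, false) | k <- js]) ->
  forall i, i \in js -> inv_by (q (gx g0 i)).
Proof.
elim: js p => // j js IHj p /andP[jjs ujs] ip ex i.
have ix : inv_by (q (gx g0 j)).
  move=> y; have := ex j y (mem_head _ _); rewrite /= eqxx !edge_sum0.
  - by rewrite !GRing.addr0 !(inv_byV ip).
  - by apply: contra jjs; rewrite -map_comp => /mapP[k kjs [->]].
  - by apply: contra jjs; rewrite -map_comp => /mapP[k kjs [->]].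
rewrite inE => /predU1P[->//|]; apply: (IHj (p * q (gx g0 j))) => //.
  exact: inv_byM.
move=> k y kjs; have := ex k y (mem_behead (s := j :: js) kjs) => /=.
case: eqP => [[jk]|_]; last by rewrite !GRing.add0r.
by rewrite jk kjs in jjs.
Qed.

(** A closed chain of faces has constant multiplicity.  The edges labelled x_i are
    compared along an orbit, because the elliptic disc lies on their other side. *)
Lemma inv_all :
  (forall i y, edge_sum chi y (ga r i) 1 R = 0%R) ->
  (forall i y, edge_sum chi y (gb r i) 1 R = 0%R) ->
  (forall i y, edge_sum chi y (gx g0 i) 1 R =
               edge_sum chi (y * q (gx g0 i))%g (gx g0 i) 1 R) ->
  forall y y', chi y = chi y'.
Proof.
rewrite surface_relE; set Z := flatten _; set C := [seq _ | _ <- _] => ea eb ex.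
have [iZ iab] : inv_by (1 * ev q Z) /\
    forall i, i \in enum 'I_g0 -> inv_by (q (ga r i)) /\ inv_by (q (gb r i)).
  apply: inv_handles inv_by1 _ => [|i y _]; first exact: enum_uniq.
  have notC x : (x \notin map fst C) -> edge_sum chi y x 1 (Z ++ C) = 0%R ->
      edge_sum chi y x 1 Z = 0%R.
    by move=> xC; rewrite edge_sum_cat [X in (_ + X)%R]edge_sum0 // GRing.addr0.
  by split; (apply: notC; [|exact: ea || exact: eb]); rewrite -map_comp; apply/mapP => -[].
have ix i : inv_by (q (gx g0 i)).
  apply: (inv_cones (enum_uniq 'I_r) iZ) (mem_enum 'I_r _) => k y _.
  have := ex k y; rewrite !edge_sum_cat ![edge_sum _ _ _ _ Z]edge_sum0 ?GRing.add0r //.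
    by apply/negP => /mem_handles[? _ []].
  by apply/negP => /mem_handles[? _ []].
have iq x : inv_by (q x).
  case: x => [i|[i|i]]; [exact: ix| |]; by case: (iab i (mem_enum _ _)).
move=> y y'; have [Y YE] := q_surj (y'^-1 * y).
have -> : y = y' * ev q Y by rewrite YE mulVKg.
elim: Y {YE} y' => [|[x b] Y IHY] y'; first by rewrite ev_nil mulg1.
by rewrite ev_cons mulgA IHY; case: b; [exact: (inv_byV (iq x)) | exact: iq].
Qed.
End Connectivity.
End Faces.

(** * Connectedness of the complement of the tree *)

Section Tree.
Import GRing.Theory.
Variables (g0 r : nat) (G : finGroupType) (q : fuchs_gen g0 r -> G).
Hypothesis q_surj : forall y : G, exists Y, ev q Y = y.
Local Notation X := (fuchs_gen g0 r).
Local Notation reps := (reps q).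
Local Notation gens := (schreier_gens q).
Local Notation Mgen := (Mgen q).
Local Notation bar := (bar q).
Implicit Types (K Y p B : word X) (s : sgen g0 r) (x : X).

Definition head_of s : word X := bar (rcons s.1 (s.2, false)).

Definition coboundary (h : word X -> int) : sgen g0 r -> int :=
  fun s => (h (head_of s) - h s.1)%R.

Lemma wt_coboundary h p Y :
  wt (coboundary h) (tau_from q p Y) = (h (bar (p ++ Y)) - h (bar p))%R.
Proof.
elim: Y p => [|[x b] Y IHY] p; first by rewrite cats0 wt_nil subrr.
rewrite /= -cat1s wt_cat IHY wt1 cat_rcons /coboundary /head_of /=; case: b.
  have -> : bar (rcons (bar (rcons p (x, true))) (x, false)) = bar p.
    apply: eq_bar; rewrite !ev_rcons ev_bar // ev_rcons.
    by rewrite !ev_cons !ev_nil !mulg1 mulgVK.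
  by rewrite opprB addrC addrA subrK.
have -> : bar (rcons (bar p) (x, false)) = bar (rcons p (x, false)).
  by apply: eq_bar; rewrite !ev_rcons ev_bar.
by rewrite addrC addrA subrK.
Qed.

(** For an edge of the tree, its end farther from the root. *)
Definition child s : word X :=
  if head_of s == rcons s.1 (s.2, false) then head_of s else s.1.

(** Both representatives are freely reduced, so that appending the letter can
    only lengthen the word or cancel its last letter. *)
Lemma Mgen_cases s : s.1 \in reps -> Mgen s ->
  head_of s = rcons s.1 (s.2, false) \/ s.1 = rcons (head_of s) (s.2, true).
Proof.
case: s => K x /= KP; rewrite /Defs.Mgen /free_eq /head_of /=.
set B := bar _; have BP : B \in reps by apply: bar_reps.
rewrite (free_red_reps q_surj BP) => /eqP BE.
have [[K' KE]|Knot] : (exists K', K = rcons K' (x, true)) \/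
    (forall K', K <> rcons K' (x, true)).
- case/lastP: (K) => [|K' l]; first by right; case.
  have [->|ne] := eqVneq l (x, true); first by left; exists K'.
  by right=> K'' /rcons_inj[_ /eqP]; rewrite (negPf ne).
- right; rewrite KE; congr rcons; rewrite -BE KE -!cats1 -catA.
  rewrite free_red_cancel (free_red_reps q_surj) //.
  by apply: (reps_rcons q_surj (l := (x, true))); rewrite -KE.
left; rewrite -BE; elim/last_ind: K KP Knot {B BP BE} => // K l _ KP Knot.
have red u : forall v, u ++ v \in reps -> (forall K', u ++ v <> rcons K' (x, true)) ->
   v != [::] -> free_red (rcons v (x, false)) = rcons v (x, false).
  move=> v; elim: v u => //= l' v IHv u uv uN _; case: v IHv uv uN => [|l'' v] IHv uv uN.
    rewrite /=; case: eqP => // -[/esym]; case: l' uv uN => x' b' /= uv uN xx bb.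
    by case: (uN u); rewrite cats1; congr (rcons _ (_, _)); rewrite // -[b']negbK -bb.
  rewrite (IHv (rcons u l')) ?cat_rcons //=.
  case: eqP => // l''E; have := reps_reduced q_surj u l' v.
  by rewrite -l''E uv.
by apply: (red [::]) => //=; rewrite -size_eq0 size_rcons.
Qed.

Lemma child_inj s s' : s.1 \in reps -> s'.1 \in reps -> Mgen s -> Mgen s' ->
  child s = child s' -> s = s'.
Proof.
case: s s' => [K x] [K' x'] /= KP K'P sM s'M; rewrite /child.
have sE := Mgen_cases (s := (K, x)) KP sM.
have s'E := Mgen_cases (s := (K', x')) K'P s'M; move: sE s'E => /=.
case: eqP => [-> _|ne [//|KE]]; case: eqP => [-> _|ne' [//|K'E]] /=.
- by move/rcons_inj => -[-> ->].
- by rewrite K'E => /rcons_inj[].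
- by rewrite {1}KE => /rcons_inj[].
by move=> KK; move: KE; rewrite KK K'E => /rcons_inj[_ ->].
Qed.

Lemma prefix_rcons_eq (T : eqType) (w u : seq T) l :
  prefix w (rcons u l) = (w == rcons u l) || prefix w u.
Proof.
apply/idP/orP => [/prefixP[v]|[/eqP->|/prefixP[v ->]]]; last first.
- by rewrite rcons_cat prefix_prefix.
- exact: prefix_refl.
case/lastP: v => [|v l']; first by rewrite cats0 => ->; left.
by rewrite -rcons_cat => /rcons_inj[-> _]; right; apply: prefix_prefix.
Qed.

(** Removing a tree edge splits the tree; the characteristic function of the
    part beyond the edge is a potential that jumps along this edge only. *)
Lemma coboundary_child w s : s.1 \in reps -> Mgen s ->
  let h := fun v => (prefix w v)%:R%R in
  coboundary h s = ((-1) ^+ (head_of s != child s) * (w == child s)%:R)%R.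
Proof.
move=> sP sM h; have notpre u l : w == rcons u l -> prefix w u = false.
  move=> /eqP ->; apply/negP => /prefixP[v] /(congr1 size).
  by rewrite size_cat size_rcons; lia.
rewrite /coboundary /child; have [hE|ne] := eqVneq (head_of s) (rcons s.1 (s.2, false)).
  rewrite /= eqxx expr0 mul1r /h hE prefix_rcons_eq.
  case: eqP => [/eqP/notpre -> |_] /=; first by rewrite subr0.
  by rewrite subrr.
case: (Mgen_cases sP sM) => [hE|sE]; first by rewrite hE eqxx in ne.
have -> : head_of s != s.1.
  by rewrite sE; apply/eqP => /(congr1 size); rewrite size_rcons; lia.
rewrite sE /h prefix_rcons_eq /= expr1 mulN1r.
case: eqP => [/eqP/notpre -> |_] /=; first by rewrite sub0r.
by rewrite subrr oppr0.
Qed.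

(** A cycle pairs to zero with every coboundary, and the potential beyond a tree
    edge isolates the coefficient of that edge. *)
Lemma tree_cycle W : word_over gens W ->
  (forall h, wt (coboundary h) W = 0%R) ->
  (forall s, s \in gens -> ~~ Mgen s -> wt (dirac s) W = 0%R) ->
  forall psi, wt psi W = 0%R.
Proof.
move=> WO Wcob WN; have ug := uniq_schreier_gens q.
suff W0 s : s \in gens -> wt (dirac s) W = 0%R.
  move=> psi; rewrite (wt_expand _ ug WO) big_seq big1 // => s /W0 ->.
  exact: mulr0.
move=> sP; have [sM|] := boolP (Mgen s); last exact: WN.
have := Wcob (fun v => (prefix (child s) v)%:R%R).
rewrite (wt_expand _ ug WO) (bigD1_seq s) //= big_seq_cond big1 => [|t].
  rewrite addr0 coboundary_child -?mem_schreier_gens // eqxx mulr1.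
  by case: (_ != _); rewrite ?expr1 ?expr0 ?mul1r //; lia.
case/andP=> tP ts; have [tM|] := boolP (Mgen t); last first.
  by move/(WN _ tP) ->; rewrite mulr0.
rewrite coboundary_child -?mem_schreier_gens //.
case: (child s =P child t) => [/child_inj E|_]; last by rewrite mulr0 mul0r.
by rewrite E -?mem_schreier_gens ?eqxx in ts.
Qed.

End Tree.

Section FacesConnected.
Variables (g0 r : nat) (G : finGroupType) (q : fuchs_gen g0 r -> G).
Variable m : 'I_r -> nat.
Hypothesis q_surj : forall y : G, exists Y, ev q Y = y.
Hypothesis q_order : forall i, #[q (gx g0 i)] = m i.
Local Notation X := (fuchs_gen g0 r).
Local Notation R := (surface_rel g0 r).
Hypothesis ev_R : ev q R = 1.
Local Notation reps := (reps q).
Local Notation gens := (schreier_gens q).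
Local Notation Mgen := (Mgen q).
Local Notation bar := (bar q).
Local Notation ell := (elliptic_relation m q).
Implicit Types (K Y p B : word X) (s : sgen g0 r) (x : X).
Import GRing.Theory.

(** The cellular 1-cochains that vanish on the boundaries of the elliptic
    discs, so that they survive the elliptic elimination. *)
Definition elliptic_closed (psi : sgen g0 r -> int) :=
  forall i K, K \in reps -> wt psi (ell i K) = 0%R.

Definition face_wt psi K := wt psi (tau q (K ++ R ++ winv K)).

Lemma wt_conj psi K Y : K \in reps -> ev q Y = 1 ->
  wt psi (tau q (K ++ Y ++ winv K)) = wt psi (tau_from q K Y).
Proof.
move=> KP Y1; rewrite tau_conj // !wt_cat wt_winv.
by rewrite addrC -addrA addNr addr0.
Qed.

Lemma wt_dirac_ell i K s : K \in reps -> s.1 \in reps ->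
  wt (dirac s) (ell i K) = (on_orbit q i K s)%:R%R.
Proof.
move=> KP sP; rewrite wt_conj // ?(ev_elliptic_rel q_order) //.
by rewrite wt_dirac !(count_orbit q_surj q_order) //=; case: on_orbit.
Qed.

Lemma closed_coboundary h : elliptic_closed (coboundary q h).
Proof.
move=> i K KP; rewrite wt_coboundary //.
by rewrite [bar _](eq_bar (Y' := [::])) ?subrr // !cat0s !ev_cat ev_winv
  (ev_elliptic_rel q_order) mul1g mulgV ev_nil.
Qed.

(** Faces that are glued along all edges outside the tree form a chain whose
    boundary is supported on the tree, hence is zero; a chain without boundary
    has constant multiplicity, so that no face is missing. *)
Theorem faces_connected W used : word_over gens W ->
  uniq used -> {subset used <= reps} -> used != [::] ->
  (forall psi, elliptic_closed psi -> wt psi W = (\sum_(K <- used) face_wt psi K)%R) ->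
  (forall s, s \in gens -> ~~ Mgen s -> wt (dirac s) W = 0%R) ->
  {subset reps <= used}.
Proof.
move=> WO uu usub u0 WF WN.
have W0 : forall psi, wt psi W = 0%R.
  apply: (tree_cycle q_surj) WO _ WN => h; rewrite WF; last exact: closed_coboundary.
  rewrite big1 // => K _; rewrite /face_wt wt_coboundary //.
  by rewrite [bar _](eq_bar (Y' := [::])) ?subrr // !cat0s 2!ev_cat ev_winv ev_R
    mul1g mulgV ev_nil.
pose chi y : int := (y \in map (ev q) used)%:R%R.
have chiE K : K \in reps -> chi (ev q K) = (K \in used)%:R%R.
  move=> KP; congr (nat_of_bool _)%:R%R; apply/mapP/idP => [[K' K'u KK]|Ku].
    by rewrite (reps_inj KP (usub _ K'u) KK).
  by exists K.
have sumE psi : elliptic_closed psi ->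
    (\sum_(K <- reps) chi (ev q K) * wt psi (tau_from q K R) = 0)%R.
  move=> cpsi; rewrite -[RHS](W0 psi) WF //.
  have pu : perm_eq used [seq K <- reps | K \in used].
    apply: uniq_perm => // [|K]; first exact/filter_uniq/uniq_reps.
    by rewrite mem_filter; case: (boolP (K \in used)) => // /usub ->.
  rewrite (perm_big _ pu) big_filter [RHS]big_mkcond /= big_seq [RHS]big_seq.
  apply: eq_bigr => K KP; rewrite chiE // /face_wt wt_conj //.
  by case: (_ \in _); rewrite ?mul1r ?mul0r.
have esum s : s.1 \in reps ->
    edge_sum q chi (ev q s.1) s.2 1 R =
    (\sum_(K <- reps) chi (ev q K) * wt (dirac s) (tau_from q K R))%R.
  move=> sP; have := sum_faces q_surj chi [::] R sP; rewrite ev_nil => <-.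
  by apply: eq_bigr => K _; rewrite cats0.
have ab0 y x : (forall i, x != gx g0 i) -> edge_sum q chi y x 1 R = 0%R.
  move=> xN; have [Y YE] := q_surj y; rewrite -YE -(ev_bar q_surj).
  have sP := bar_reps q_surj Y; rewrite (esum (bar Y, x) sP) sumE //.
  by move=> i K KP; rewrite wt_dirac_ell // /on_orbit (negPf (xN i)).
have chi_const : forall y y', chi y = chi y'.
  apply: (inv_all q_surj) => [i y|i y|i y]; [exact: ab0|exact: ab0|].
  have [Y YE] := q_surj y; have sP := bar_reps q_surj Y.
  pose B' := bar (rcons Y (gx g0 i, false)).
  have B'P : B' \in reps by apply: bar_reps.
  have B'E : ev q B' = y * q (gx g0 i).
    by rewrite ev_bar // ev_rcons YE ev_cons ev_nil mulg1.
  rewrite -B'E -YE -(ev_bar q_surj Y) (esum (bar Y, _) sP) (esum (B', _) B'P).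
  apply/eqP; rewrite -subr_eq0 -sumrB.
  under eq_bigr do rewrite -mulrBr -wtB.
  rewrite sumE // => j K KP; rewrite wtB !wt_dirac_ell // /on_orbit /= B'E.
  rewrite ev_bar // YE; case: eqP => [[->]|_]; last by rewrite subrr.
  by rewrite !mem_lcoset mulgA (groupMr _ (cycle_id _)) subrr.
case: used u0 {uu} usub chi chiE {WF sumE esum ab0} chi_const => // K0 used _ usub chi chiE cst K KP.
have K0P : K0 \in reps by apply/usub/mem_head.
by have := cst (ev q K) (ev q K0); rewrite !chiE // mem_head; case: (K \in _).
Qed.
End FacesConnected.

(** * Gluing *)

Section Gluing.
Variables (g0 r : nat) (G : finGroupType) (q : fuchs_gen g0 r -> G).
Variable m : 'I_r -> nat.
Hypothesis q_surj : forall y : G, exists Y, ev q Y = y.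
Hypothesis q_order : forall i, #[q (gx g0 i)] = m i.
Hypothesis ev_R : ev q (surface_rel g0 r) = 1.
Variables (Gamma0 : groupType) (L : Gamma0 -> Prop) (f : sgen g0 r -> Gamma0).
Local Notation X := (fuchs_gen g0 r).
Local Notation reps := (reps q).
Local Notation gens := (schreier_gens q).
Local Notation Mgen := (Mgen q).
Local Notation state := (seq (sgen g0 r) * seq (word (sgen g0 r)))%type.
Implicit Types (K : word X) (s : sgen g0 r) (P : state) (l : sgen g0 r * bool).
Implicit Types (W V : word (sgen g0 r)).

Lemma glue_step_split gs W others : has (gluable q others) W ->
  exists l W1 W2 V1 V2 O1 O2,
  [/\ ~~ Mgen l.1, W = W1 ++ l :: W2, others = O1 ++ (V1 ++ linv l :: V2) :: O2
    & glue_step q (gs, W :: others) =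
      (rem l.1 gs, (W1 ++ V2 ++ V1 ++ W2) :: O1 ++ O2)].
Proof.
rewrite has_filter /glue_step /=; case lE : [seq l <- W | gluable q others l] => [//|l t] _.
have : l \in [seq l <- W | gluable q others l] by rewrite lE mem_head.
rewrite mem_filter => /andP[/andP[lM lV] lW].
set j := find _ others; set V := nth _ _ j.
have lVin : linv l \in V by apply: (nth_find [::] lV).
exists l, (take (index l W) W), (drop (index l W).+1 W),
  (take (index (linv l) V) V), (drop (index (linv l) V).+1 V),
  (take j others), (drop j.+1 others).
split=> //; first exact: split_at.
by rewrite -split_at // -drop_nth ?cat_take_drop // -has_find.
Qed.

(** The first relation is the boundary of a disc glued from the faces of used,
    the others are the faces of rest.  The faces are remembered only through the
    cochains that vanish on the elliptic discs, as these are unaffected by the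
    elimination and additive under gluing. *)
Definition glued_state P :=
  [/\ uniq P.1 /\ {subset P.1 <= gens},
      presents L P.1 f (P.2 ++ Mrels q P.1),
      forall s e, s \in P.1 -> ~~ Mgen s -> count_mem (s, e) (flatten P.2) = 1%N
    & exists used rest, [/\ perm_eq (used ++ rest) reps, used != [::] &
       forall psi, elliptic_closed q m psi -> map (wt psi) P.2 =
        (\sum_(K <- used) face_wt q psi K)%R :: map (face_wt q psi) rest]].

(** If no letter could be glued, each letter outside the tree would cancel within
    the disc, and the disc would be the whole surface. *)
Lemma glued_gluable gs W V others : glued_state (gs, W :: V :: others) ->
  has (gluable q (V :: others)) W.
Proof.
set O := V :: others; case=> [[ug gsub] presP cnt [used [rest [prest u0 wtP]]]].
apply: contraT => /hasPn noglue; have [_ _ relsO _] := presP.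
have WO : word_over gs W by apply: (allP relsO); rewrite mem_cat mem_head.
have uur : uniq (used ++ rest) by rewrite (perm_uniq prest) uniq_reps.
have [K [rest' restE]] : exists K rest', rest = K :: rest'.
  have /(congr1 size) := wtP (fun => 0%R) (fun _ _ _ => wt0 _).
  case: (rest) => [|K rest'] //=; by exists K, rest'.
have opp s b : s \in gs -> ~~ Mgen s -> (s, b) \in W -> count_mem (s, ~~ b) W = 1%N.
  move=> sg sM sW; rewrite -(cnt s (~~ b) sg sM) /= count_cat -[LHS]addn0.
  congr (_ + _)%N; rewrite -[V ++ _]/(flatten O).
  apply/esym/count_memPn/negP => /flattenP[V' V'O sV'].
  move/negP: (noglue _ sW); apply.
  by apply/andP; split=> //; apply/hasP; exists V'.
have KU : K \in used.
  apply: (faces_connected q_surj q_order ev_R (W := W) (used := used)).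
  - exact: sub_word_over gsub WO.
  - by move: uur; rewrite cat_uniq => /and3P[].
  - by move=> K' K'u; rewrite -(perm_mem prest) mem_cat K'u.
  - exact: u0.
  - by move=> psi /wtP[].
  - move=> s sg sM; rewrite wt_dirac.
    have [sgs|sN] := boolP (s \in gs); last first.
      by rewrite !((word_over_count _ _).1 WO).
    have [sW|sW] := boolP ((s, false) \in W).
      have c1 := opp _ _ sgs sM sW; have sW' : (s, true) \in W.
        by rewrite -has_pred1 has_count c1.
      by rewrite c1 (opp _ _ sgs sM sW').
    have [sW'|sW'] := boolP ((s, true) \in W).
      by have /= := opp _ _ sgs sM sW'; rewrite (count_memPn sW).
    by rewrite (count_memPn sW) (count_memPn sW').
  by rewrite -(perm_mem prest) mem_cat restE mem_head orbT.
by move: uur; rewrite cat_uniq restE /= KU => /and3P[].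
Qed.
(** The glued generator occurs once in W and once, inverted, in V; so solving V
    for it affects only W, and the other letters keep their multiplicity. *)
Lemma glued_step gs W V others : glued_state (gs, W :: V :: others) ->
  glued_state (glue_step q (gs, W :: V :: others)) /\
  size (glue_step q (gs, W :: V :: others)).2 = (size others).+1.
Proof.
move=> gluedP; have [l [W1 [W2 [V1 [V2 [O1 [O2 [lM WE OE stepE]]]]]]]] :=
  glue_step_split gs (glued_gluable gluedP).
set O := V :: others in OE stepE gluedP *; rewrite stepE.
set V' := V1 ++ _ in OE; split; last first.
  have /(congr1 size) := OE; rewrite /= !size_cat /= addnS => -[->].
  by [].
have [[ug gsub] presP cnt [used [rest [prest u0 wtP]]]] := gluedP.
have [_ _ relsO _] := presP; set s := l.1.
have WO : word_over gs W by apply: (allP relsO); rewrite mem_cat mem_head.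
have V'in : V' \in O by rewrite OE mem_cat mem_head orbT.
have V'rel : V' \in (W :: O) ++ Mrels q gs by rewrite mem_cat in_cons V'in !orbT.
have V'O : word_over gs V' := allP relsO _ V'rel.
have sg : s \in gs by apply: (allP WO); rewrite WE mem_cat mem_head orbT.
have cntE t b : count_mem (t, b) (flatten (W :: O)) =
    (count_mem (t, b) (W1 ++ V2 ++ V1 ++ W2) + count_mem (t, b) (flatten (O1 ++ O2))
     + ((l == (t, b)) + (linv l == (t, b))))%N.
  have flO : flatten O = flatten O1 ++ V' ++ flatten O2 by rewrite OE flatten_cat.
  rewrite -[flatten (W :: O)]/(W ++ flatten O) flO flatten_cat.
  rewrite WE /V' -[l :: W2]cat1s -[linv l :: V2]cat1s.
  rewrite 9!count_cat -[count _ [:: l]]/(_ + 0)%N -[count _ [:: linv l]]/(_ + 0)%N.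
  rewrite !addn0 !count_cat.
  move: (nat_of_bool _) (nat_of_bool _) (count _ W1) (count _ W2) (count _ V1).
  by move: (count _ V2) (count _ (flatten O1)) (count _ (flatten O2)); clear; lia.
have lone b : ((l == (s, b)) + (linv l == (s, b)) = 1)%N.
  by rewrite /s; case: (l) b => t [] []; rewrite /linv /= !xpair_eqE eqxx.
have zero b : count_mem (s, b) (W1 ++ V2 ++ V1 ++ W2) = 0%N /\
    count_mem (s, b) (flatten (O1 ++ O2)) = 0%N.
  have := cnt s b sg lM; rewrite -[flatten _]/(flatten (W :: O)) cntE lone addn1.
  by case=> /eqP; rewrite addn_eq0 => /andP[/eqP -> /eqP ->].
have zeroW b : [/\ count_mem (s, b) W1 = 0%N, count_mem (s, b) W2 = 0%N &
    count_mem (s, b) (V2 ++ V1) = 0%N].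
  have /eqP := (zero b).1; rewrite !count_cat !addn_eq0.
  by case/and4P=> /eqP-> /eqP-> /eqP-> /eqP->.
pose u := if ~~ l.2 then V2 ++ V1 else winv (V2 ++ V1).
have VVO : word_over (rem s gs) (V2 ++ V1).
  apply: word_over_rem => // [|b]; last by case: (zeroW b).
  move: V'O; rewrite /V' -cat1s !word_over_cat => /and3P[-> _ ->] //.
have uO : word_over (rem s gs) u.
  by rewrite /u; case: (~~ _); rewrite ?word_over_winv.
have subW : wsubst (replace s u) W = W1 ++ V2 ++ V1 ++ W2.
  have W10 b : count_mem (s, b) W1 = 0%N by case: (zeroW b).
  have W20 b : count_mem (s, b) W2 = 0%N by case: (zeroW b).
  rewrite WE -cat1s !wsubst_cat (replace_id _ W10) (replace_id _ W20).
  rewrite (_ : wsubst _ [:: l] = V2 ++ V1) -?catA // /wsubst /= cats0 /replace eqxx.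
  by rewrite /u; case: (l.2); rewrite //= winvK.
have subO w : w \in O1 ++ O2 -> wsubst (replace s u) w = w.
  move=> wO; apply: replace_id => b; apply/count_memPn; apply/negP => sw.
  have /count_memPn/negP := (zero b).2; apply; apply/flattenP; by exists w.
have OsubO w : w \in O1 ++ O2 -> w \in O.
  by rewrite OE !mem_cat inE => /orP[]->; rewrite ?orbT.
have V'E : V' = V1 ++ (s, ~~ l.2) :: V2 by [].
have rel1 w := presents_rel (w := w) presP.
have uf : ev f u = f s by apply: ev_solved; rewrite -V'E rel1.
have newO : all (word_over (rem s gs))
    (((W1 ++ V2 ++ V1 ++ W2) :: O1 ++ O2) ++ Mrels q (rem s gs)).
  rewrite all_cat Mrels_over andbT; apply/allP => w; rewrite inE => /predU1P[->|wO].
    by rewrite -subW replace_over.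
  rewrite -(subO w wO); apply: replace_over => //; apply: (allP relsO).
  by rewrite mem_cat inE OsubO ?orbT.
split.
- by split; [exact: rem_uniq|move=> t /mem_rem/gsub].
- apply: (presents_solve presP ug uO uf newO) => w.
    rewrite !mem_cat inE => /orP[/predU1P[->|wO]|/mapP[t]].
    + by rewrite -subW ev_replace // rel1 // mem_cat mem_head.
    + by rewrite rel1 // mem_cat inE OsubO ?orbT.
    by rewrite mem_filter => /andP[tM /mem_rem tg] ->; rewrite rel1 // mem_cat mem_Mrels ?orbT.
  rewrite !mem_cat inE => /orP[/predU1P[->|]|/mapP[t]].
  + by rewrite subW; apply: triv_rel; rewrite mem_cat mem_head.
  + rewrite OE mem_cat inE => /or3P[wO1|/eqP ->|wO2].
    * rewrite subO ?mem_cat ?wO1 //.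
      by apply: triv_rel; rewrite !(mem_cat, inE) wO1 !orbT.
    * by apply: (triv_solved (~~ l.2) newO VVO) => b; case: (zeroW b).
    rewrite subO ?mem_cat ?wO2 ?orbT //.
    by apply: triv_rel; rewrite !(mem_cat, inE) wO2 !orbT.
  rewrite mem_filter => /andP[tM tg] ->; rewrite wsubst1 /replace.
  case: eqVneq => [ts|ts]; first by rewrite -/s -ts tM in lM.
  by apply: triv_rel; rewrite mem_cat mem_Mrels ?orbT // mem_rem_uniq // inE ts.
- move=> t b; rewrite mem_rem_uniq // inE => /andP[ts tg] tM.
  have := cnt t b tg tM; rewrite /= -/(flatten (W :: O)) cntE.
  have lt : (l == (t, b)) = false.
    by apply: contraNF ts => /eqP lE; rewrite /s lE.
  have lt' : (linv l == (t, b)) = false.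
    by apply: contraNF ts => /eqP lE; rewrite -[s]/((linv l).1) lE.
  by rewrite lt lt' addn0 -count_cat.
have szr : size rest = size O.
  have /(congr1 size) := wtP (fun=> 0%R) (fun _ _ _ => wt0 _).
  by rewrite /= !size_map => -[].
have szO : size O = (size O1 + (size O2).+1)%N by rewrite OE size_cat.
have restE : rest = take (size O1) rest ++ drop (size O1) rest by rewrite cat_take_drop.
case dE : (drop (size O1) rest) restE => [|K R2] restE.
  by move/(congr1 size): dE; rewrite size_drop szr szO addKn.
set R1 := take _ _ in restE.
exists (K :: used), (R1 ++ R2); split=> //.
  apply: perm_trans prest; rewrite restE; apply/seq.permP => a.
  rewrite /= !count_cat /=; move: (nat_of_bool _) (count _ _) (count _ _) (count _ _).
  by clear; lia.
move=> psi /wtP psiE.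
have WS : wt psi W = (\sum_(K <- used) face_wt q psi K)%R := congr1 (head 0%R) psiE.
have : map (wt psi) O = map (face_wt q psi) rest := congr1 behead psiE.
rewrite OE restE !map_cat => /eqP.
rewrite eqseq_cat; last by rewrite !size_map /R1 size_take szr szO -addSnnS ltn_addr.
case/andP=> /eqP E1 /eqP[EV E2]; rewrite /= !map_cat E1 E2 big_cons -EV -WS.
congr (_ :: _); rewrite WE /V' -[l :: W2]cat1s -[linv l :: V2]cat1s !wt_cat.
have -> : wt psi [:: linv l] = (- wt psi [:: l])%R by rewrite -wt_winv.
by move: (wt psi W1) (wt psi W2) (wt psi V1) (wt psi V2) (wt psi [:: l]); clear; lia.
Qed.

Lemma glued_iter k P : glued_state P -> size P.2 = k.+1 ->
  glued_state (iter k (glue_step q) P) /\ size (iter k (glue_step q) P).2 = 1%N.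
Proof.
elim: k P => // k IHk [gs [|W [|V others]]] //= gluedP [szo].
have [gluedP' szP'] := glued_step gluedP.
by rewrite -iterS iterSr; apply: IHk; rewrite // szP' -szo.
Qed.

End Gluing.

(** * Contraction of the tree *)

Section TreeElimination.
Variables (g0 r : nat) (G : finGroupType) (Gamma0 : groupType).
Variables (q : fuchs_gen g0 r -> G) (c : fuchs_gen g0 r -> Gamma0).
Variable L : Gamma0 -> Prop.
Local Notation f := (fun s : sgen g0 r => ev c (schreier_word q s)).
Local Notation Mgen := (Mgen q).

Definition kill_M (s : sgen g0 r) : word (sgen g0 r) :=
  if Mgen s then [::] else [:: (s, false)].

Lemma wsubst_kill_M w : wsubst kill_M w = [seq l <- w | ~~ Mgen l.1].
Proof.
elim: w => // -[s b] w IHw; rewrite -cat1s wsubst_cat IHw /wsubst /= cats0.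
by rewrite /kill_M; case: (Mgen s); case: b.
Qed.

Lemma presents_M_elim gs rels :
  presents L gs f (rels ++ Mrels q gs) ->
  presents L (M_elim q (gs, rels)).1 f (M_elim q (gs, rels)).2.
Proof.
move=> presP; have [_ _ relsO _] := presP.
have rel1 w := presents_rel (w := w) presP.
have fM s : ev f (kill_M s) = f s.
  by rewrite /kill_M; case: ifP => [/ev_Mgen->|_]; rewrite ?ev_nil // ev_cons ev_nil mulg1.
have filtE : [seq [seq l <- w | ~~ Mgen l.1] | w <- rels] = map (wsubst kill_M) rels.
  by apply: eq_map => w; rewrite wsubst_kill_M.
have kO s : s \in gs -> word_over [seq s <- gs | ~~ Mgen s] (kill_M s).
  by move=> sg; rewrite /kill_M; case: ifPn => // sM; rewrite /word_over /= mem_filter sM sg.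
rewrite /M_elim filtE /=; apply: (presents_elim (th := kill_M) presP).
- by move=> s; rewrite mem_filter => /andP[].
- apply/allP => _ /mapP[w wP ->]; apply: word_over_wsubst kO _.
  by apply: (allP relsO); rewrite mem_cat wP.
- by move=> s sg; split; [exact: kO|exact: fM].
- by move=> s; rewrite mem_filter /kill_M => /andP[/negPf->].
- move=> _ /mapP[w wP ->]; rewrite ev_wsubst (eq_ev _ fM).
  by apply: rel1; rewrite mem_cat wP.
move=> w; rewrite mem_cat => /orP[wP|/mapP[s]].
  exact/triv_rel/map_f.
rewrite mem_filter => /andP[sM _] ->; rewrite wsubst1 /kill_M sM.
exact: Tnil.
Qed.
End TreeElimination.

(** * The number of generators *)

Section Abelianization.
Variables (T : eqType) (H : groupType) (L : H -> Prop) (f : T -> H).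
Variables (gens : seq T) (W : word T).
Hypothesis presL : presents L gens f [:: W].
Hypothesis uniq_gens : uniq gens.
Hypothesis W0 : forall s, s \in gens -> wt (dirac s) W = 0%R.
Hypotheses (L1 : L 1) (LM : forall u v, L u -> L v -> L (u * v)).
Hypothesis LV : forall u, L u -> L u^-1.
Implicit Types (w : word T) (s : T).
Import GRing.Theory.
Local Notation k := (size gens).

Definition exponents w : 'rV[int]_k :=
  (\row_i wt (dirac (tnth (in_tuple gens) i)) w)%R.

Lemma exponents_cat u w : exponents (u ++ w) = (exponents u + exponents w)%R.
Proof. by apply/rowP => i; rewrite !mxE wt_cat. Qed.

Lemma exponents_nil : exponents [::] = 0%R.
Proof. by apply/rowP => i; rewrite !mxE wt_nil. Qed.

Lemma exponents_winv w : exponents (winv w) = (- exponents w)%R.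
Proof. by apply/rowP => i; rewrite !mxE wt_winv. Qed.

Lemma exponents_gen i :
  exponents [:: (tnth (in_tuple gens) i, false)] = delta_mx 0%R i.
Proof.
apply/rowP => j; rewrite !mxE wt1 /dirac eqxx eq_sym /=; congr (_ _)%:R%R.
by apply/eqP/eqP => [/tuple_uniqP|->//]; exact.
Qed.

Lemma wt_triv w s : trivial_in gens [:: W] w -> s \in gens -> wt (dirac s) w = 0%R.
Proof.
move=> tw sg; elim: tw => {w} [|u v [t b] _ _|u v [t b] _|u v w w1 _|u v w w1 _].
- exact: wt_nil.
- by rewrite -cat1s !wt_cat !wt1; case: b => /=; rewrite ?addNr ?subrr; lia.
- by rewrite -cat1s !wt_cat !wt1; case: b => /=; lia.
- by move: w1; rewrite inE => /eqP ->; rewrite !wt_cat W0 // add0r.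
by move: w1; rewrite inE => /eqP ->; rewrite !wt_cat W0 // add0r.
Qed.

Lemma exponents_ev w w' : word_over gens w -> word_over gens w' ->
  ev f w = ev f w' -> exponents w = exponents w'.
Proof.
move=> wO w'O ww'; have [_ _ _ trivP] := presL.
have : trivial_in gens [:: W] (w ++ winv w').
  apply/trivP; first by rewrite word_over_cat wO word_over_winv.
  by rewrite ev_cat ev_winv ww' mulgV.
move=> tw; apply/rowP => i; rewrite !mxE; apply/eqP; rewrite -subr_eq0.
by rewrite -wt_winv -wt_cat wt_triv // mem_tnth.
Qed.

Lemma ev_in w : word_over gens w -> L (ev f w).
Proof.
have [fL _ _ _] := presL.
elim: w => [|[s b] w IHw] /=; first by rewrite ev_nil.
case/andP=> /fL Ls /IHw Lw; rewrite ev_cons; apply: LM => //=.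
by case: b => //; apply: LV.
Qed.

Lemma derived_word d : derived L d ->
  exists2 w, word_over gens w & ev f w = d /\ exponents w = 0%R.
Proof.
have [_ genL _ _] := presL.
elim=> [|u v d' /genL[wu wuO <-] /genL[wv wvO <-] _ [w wO [<- w0]]].
  by exists [::] => //; rewrite ev_nil exponents_nil.
exists (winv wu ++ winv wv ++ wu ++ wv ++ w).
  by rewrite !word_over_cat !word_over_winv wuO wvO.
rewrite !ev_cat !ev_winv !exponents_cat !exponents_winv w0 addr0; split.
  by rewrite commgEl conjgE !mulgA.
by rewrite addrA addrACA !addNr addr0.
Qed.

Lemma exponents_surj x : exists2 w, word_over gens w & exponents w = x.
Proof.
pose S x := exists2 w, word_over gens w & exponents w = x.
have SD x1 x2 : S x1 -> S x2 -> S (x1 + x2)%R.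
  move=> [w1 w1O <-] [w2 w2O <-]; exists (w1 ++ w2).
    by rewrite word_over_cat w1O.
  exact: exponents_cat.
have SN x1 : S x1 -> S (- x1)%R.
  move=> [w1 w1O <-]; exists (winv w1); first by rewrite word_over_winv.
  exact: exponents_winv.
have S0 : S 0%R by exists [::]; rewrite ?exponents_nil.
rewrite -/(S x) [x]row_sum_delta; apply: big_ind => // i _.
have Sn n : S (n%:Z *: delta_mx 0 i)%R.
  elim: n => [|n IHn]; first by rewrite scale0r.
  rewrite intS scalerDl scale1r; apply: SD IHn.
  exists [:: (tnth (in_tuple gens) i, false)]; last exact: exponents_gen.
  by rewrite /word_over /= mem_tnth.
case: (x 0%R i) => n; first exact: Sn.
by rewrite NegzE scaleNr; apply: SN.
Qed.

(** As the relator has zero exponent sums, exponents are defined on L and vanish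
    on its commutators.  Hence h and the exponents determine each other, which
    makes the matrix of h on the generators invertible, hence square. *)
Lemma size_genus g : quotient_genus L g -> k = (2 * g)%N.
Proof.
case=> h [hD hsurj hder]; have [fL genL _ _] := presL.
have h1 : h 1 = 0%R by apply: (addrI (h 1)); rewrite -hD // mulg1 addr0.
have hV u : L u -> h u^-1 = (- h u)%R.
  move=> Lu; apply: (addrI (h u)); rewrite -hD ?mulgV ?h1 ?subrr //.
  exact: LV.
pose B : 'M[int]_(k, 2 * g) := (\matrix_i h (f (tnth (in_tuple gens) i)))%R.
have hE w : word_over gens w -> h (ev f w) = (exponents w *m B)%R.
  elim: w => [|[s b] w IHw] /=; first by rewrite ev_nil exponents_nil mul0mx.
  case/andP=> /= sg wO; rewrite -cat1s exponents_cat mulmxDl -IHw // ev_cat hD; last 2 first.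
  - by apply: ev_in; rewrite /word_over /= sg.
  - exact: ev_in.
  congr (_ + _)%R.
  have sE : (exponents [:: (s, false)] *m B)%R = h (f s).
    have si : (index s gens < k)%N by rewrite index_mem.
    have -> : s = tnth (in_tuple gens) (Ordinal si) by rewrite (tnth_nth s) nth_index.
    by rewrite exponents_gen -rowE rowK.
  rewrite ev_cons ev_nil mulg1; case: b => /=; last by rewrite sE.
  rewrite hV; last exact: fL.
  by rewrite -sE -mulNmx -exponents_winv.
have [A AB] : exists A : 'M[int]_(2 * g, k), (A *m B = 1%:M)%R.
  have /fin_all_exists[w wP] j : exists w, word_over gens w /\
      h (ev f w) = delta_mx 0%R j.
    by have [u /genL[w wO <-] hu] := hsurj (delta_mx 0%R j); exists w.
  exists (\matrix_j exponents (w j))%R; apply/row_matrixP => j.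
  by have [wO wE] := wP j; rewrite row_mul rowK -hE // wE row1.
have Binj (x : 'rV[int]_k) : (x *m B = 0)%R -> x = 0%R.
  have [w wO <-] := exponents_surj x; rewrite -hE // => /(hder _ (ev_in wO)).
  by case/derived_word=> w' w'O [w'E <-]; apply: exponents_ev.
have BA : (B *m A = 1%:M)%R.
  apply/row_matrixP => i; apply/eqP; rewrite -subr_eq0; apply/eqP/Binj.
  by rewrite mulmxBl -row_mul -mulmxA AB mulmx1 -row_mul mul1mx subrr.
by apply/eqP; rewrite eqn_leq (mulmx1_min AB) (mulmx1_min BA).
Qed.
End Abelianization.

(** * The algorithm *)

Section ChoiceExists.
Variables (g0 r : nat) (G : finGroupType) (q : fuchs_gen g0 r -> G).
Variable m : 'I_r -> nat.
Hypothesis q_surj : forall y : G, exists Y, ev q Y = y.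
Hypothesis q_order : forall i, #[q (gx g0 i)] = m i.
Local Notation X := (fuchs_gen g0 r).
Local Notation reps := (reps q).
Local Notation Mgen := (Mgen q).
Local Notation ell := (elliptic_relation m q).
Implicit Types (K : word X) (i : 'I_r).

(** Along an edge of the tree labelled x_i the length of the representative
    goes up by one, as no representative contains x_i^-1; so the closed path of
    an elliptic relation leaves the tree. *)
Lemma ell_has_nonM i K : K \in reps ->
  has (fun t => ~~ t.2 && ~~ Mgen t.1) (ell i K).
Proof.
move=> KP; pose h (w : word X) : int := (size w)%:Z%R.
have := closed_coboundary q_surj q_order h i KP.
rewrite wt_conj // ?(ev_elliptic_rel q_order) //.
have -> : ell i K = tau q K ++ tau_from q K (elliptic_rel g0 m i) ++ winv (tau q K).
  by apply: tau_conj; rewrite // (ev_elliptic_rel q_order).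
apply: contra_eqT => noN; rewrite !has_cat !negb_or in noN.
have {noN} : ~~ has (fun t => ~~ t.2 && ~~ Mgen t.1) (tau_from q K (elliptic_rel g0 m i)).
  by case/and3P: noN.
rewrite [elliptic_rel _ _ _]/(xpow g0 i (m i)) tau_from_xpow.
have m0 : (0 < m i)%N by rewrite -q_order order_gt0.
move=> /hasPn noN; suff -> : wt (coboundary q h)
    [seq (bar q (K ++ xpow g0 i k), gx g0 i, false) | k <- iota 0 (m i)] = (m i)%:Z%R.
  by case: (m i) m0.
elim: {m0}(m i) 0%N noN => [|k IHk] j noN; first by rewrite wt_nil.
rewrite /= -cat1s wt_cat wt1 IHk /=; last first.
  by move=> t tP; apply: noN; rewrite /= inE tP orbT.
have /= := noN _ (mem_head _ _); rewrite negbK; set B := bar q _ => BM.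
have BP : B \in reps by apply: bar_reps.
suff -> : coboundary q h (B, gx g0 i) = 1%R by lia.
have [] := Mgen_cases q_surj (s := (B, gx g0 i)) BP BM; rewrite /coboundary /h /=.
  by move=> ->; rewrite size_rcons; lia.
move=> BE; have := reps_alphabet BP; rewrite BE all_rcons => /andP[+ _].
by rewrite /= mem_alphabet.
Qed.

Lemma elliptic_choice_ex : exists e, elliptic_choice m q e.
Proof.
pose C i y := y *: <[q (gx g0 i)]>.
pose sel i K := (head ((K, gx g0 i), false)
  [seq t <- ell i K | ~~ t.2 && ~~ Mgen t.1]).1.
have selP i K : K \in reps -> (sel i K, false) \in ell i K /\ ~~ Mgen (sel i K).
  move/(ell_has_nonM i); rewrite has_filter /sel.
  case tE : [seq t <- _ | _] => [//|[s b] t] _ /=.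
  have : (s, b) \in [seq t <- ell i K | ~~ t.2 && ~~ Mgen t.1] by rewrite tE mem_head.
  by rewrite mem_filter /= => /andP[/andP[/negPf -> sM] ->].
(* repr picks one coset in each orbit, hence one representative K. *)
exists (fun i => [seq (K, sel i K) | K <- reps & ev q K == repr (C i (ev q K))]).
move=> i; split=> [_ /mapP[_ /mapP[K KP ->] ->]|K KP|_ /mapP[K KP ->]].
- by move: KP; rewrite mem_filter => /andP[].
- rewrite count_map count_filter.
  have -> : count (fun K' => (ev q K' \in C i (ev q K)) &&
      (ev q K' == repr (C i (ev q K')))) reps =
      count (pred1 (repr (C i (ev q K)))) [seq ev q K' | K' <- reps].
    rewrite count_map; apply: eq_count => K' /=; apply/andP/eqP.
      by case=> /lcoset_eqP E /eqP ->; rewrite /C E.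
    move=> KE; have K'C : ev q K' \in C i (ev q K).
      by rewrite KE; apply: (mem_repr (ev q K)); apply: lcoset_refl.
    by split=> //; rewrite {1}KE /C (lcoset_eqP K'C).
  by rewrite (seq.permP (perm_reps q_surj)) count_uniq_mem ?enum_uniq // mem_enum.
by move: KP; rewrite mem_filter => /andP[_ KP]; apply: selP.
Qed.
End ChoiceExists.

Section Assembly.
Variables (g0 r : nat) (G : finGroupType) (Gamma0 : groupType).
Variables (c : fuchs_gen g0 r -> Gamma0) (phi : {multiplicative Gamma0 -> G}).
Local Notation X := (fuchs_gen g0 r).
Local Notation q := (fun v => phi (c v)).
Variable m : 'I_r -> nat.
Hypothesis pres0 : presents (fun _ => True) (enum X) c (rels0 g0 r m).
Hypothesis q_surj : forall y : G, exists Y, ev q Y = y.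
Hypothesis q_order : forall i, #[q (gx g0 i)] = m i.
Local Notation f := (fun s : sgen g0 r => ev c (schreier_word q s)).
Local Notation gens := (schreier_gens q).
Local Notation reps := (reps q).
Local Notation ell := (elliptic_relation m q).
Implicit Types (K Y : word X) (i : 'I_r).

Lemma ev_surface_rel : ev q (surface_rel g0 r) = 1.
Proof. by apply: (ev_q_rel phi pres0); rewrite inE eqxx. Qed.

(** The elliptic relations along one orbit are conjugate: they read the same
    closed path from different starting points. *)
Lemma triv_ell_orbit gs rels i K K' :
  all (word_over gs) rels -> {subset gens <= gs} ->
  K \in reps -> K' \in reps -> ev q K \in ev q K' *: <[q (gx g0 i)]> ->
  trivial_in gs rels (ell i K') -> trivial_in gs rels (ell i K).
Proof.
move=> rO gsub KP K'P; rewrite mem_lcoset => /cyclePmin[j jm jE].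
have over p Y : word_over gs (tau_from q p Y).
  by apply: sub_word_over gsub _; apply: tau_from_over.
have ex1 := ev_elliptic_rel q_order i.
rewrite /elliptic_relation !tau_conj // => T.
apply: (triv_conj rO _ (over [::] K)).1; move/(triv_conj rO _ (over [::] K')).2: T => T.
have mE : m i = (j + (m i - j))%N by rewrite subnKC // ltnW // -q_order.
have xE a b : xpow g0 i (a + b) = xpow g0 i a ++ xpow g0 i b by apply: nseqD.
have E1 : elliptic_rel g0 m i = xpow g0 i j ++ xpow g0 i (m i - j).
  by rewrite -xE -mE.
have E2 : elliptic_rel g0 m i = xpow g0 i (m i - j) ++ xpow g0 i j.
  by rewrite -xE addnC -mE.
have KE : ev q K = ev q (K' ++ xpow g0 i j).
  by rewrite ev_cat ev_xpow -jE mulVKg.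
move: T; rewrite {1}E1 E2 !tau_from_cat => /(triv_rot rO (over _ _)).
rewrite (eq_tau_from _ KE) (eq_tau_from (p := K ++ _) (p' := K')) //.
by rewrite ev_cat KE -ev_cat -catA -E1 ev_cat ex1 mulg1.
Qed.

(** Of the conjugate elliptic relations along each orbit one suffices. *)
Lemma presents_initial e : elliptic_choice m q e ->
  presents (in_kernel phi) gens f
   ((initial q).2 ++ Mrels q gens ++ [seq ell_of q m it | it <- choices e]).
Proof.
move=> eP; set ells := [seq ell i K | i <- enum 'I_r, K <- reps].
have pres1 : presents (in_kernel phi) gens f ((R_relations q ++ ells) ++ Mrels q gens).
  apply: (presents_schreier pres0 q_surj) => [w|K w0 KP].
    rewrite mem_cat => /orP[/mapP[K KP ->]|/allpairsP[[i K] /= [_ KP ->]]].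
      by exists K, (surface_rel g0 r); split=> //; rewrite mem_head.
    exists K, (elliptic_rel g0 m i); split=> //.
    by rewrite inE map_f ?orbT // mem_enum.
  rewrite inE => /predU1P[->|/mapP[i _ ->]]; rewrite mem_cat.
    by rewrite (map_f (fun K => tau q (K ++ surface_rel g0 r ++ winv K))).
  by apply/orP; right; apply/allpairsP; exists (i, K); rewrite mem_enum.
have [_ _ rO _] := pres1; have rel1 w := presents_rel (w := w) pres1.
have choiceP it : it \in choices e -> ell_of q m it \in ells.
  move=> itP; have [KP _ _ _] := (independent_choices q_surj q_order eP).1 it itP.
  by apply/allpairsP; exists (it.1, it.2.1); rewrite mem_enum.
have sub w : w \in (initial q).2 ++ Mrels q gens ++ [seq ell_of q m it | it <- choices e] ->
    w \in (R_relations q ++ ells) ++ Mrels q gens.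
  rewrite !mem_cat => /or3P[->//|->|/mapP[it itP ->]]; rewrite ?orbT //.
  by rewrite choiceP // orbT.
have newO : all (word_over gens)
    ((initial q).2 ++ Mrels q gens ++ [seq ell_of q m it | it <- choices e]).
  by apply/allP => w /sub; apply: (allP rO).
apply: (presents_rels pres1 newO) => [w /sub/rel1//|w].
rewrite !mem_cat -orbA => /or3P[wR|/allpairsP[[i K] /= [_ KP ->]]|wM].
- by apply: triv_rel; rewrite mem_cat wR.
- have : has (fun t => ev q t.1 \in ev q K *: <[q (gx g0 i)]>) (e i).
    by rewrite has_count; have [_ /(_ K KP) -> _] := eP i.
  case/hasP=> t te tK; have itP : (i, t) \in choices e by rewrite mem_choices.
  have [tP _ _ _] := (independent_choices q_surj q_order eP).1 _ itP.
  apply: (triv_ell_orbit newO _ KP tP); first by [].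
    by rewrite lcoset_sym.
  by apply: triv_rel; rewrite !mem_cat (map_f _ itP) !orbT.
- by apply: triv_rel; rewrite !mem_cat wM !orbT.
Qed.

(** Before any gluing the disc is the first face. *)
Lemma glued_elliptic e : elliptic_choice m q e ->
  glued_state q m (in_kernel phi) f (elliptic_elim m q e (initial q)) /\
  size (elliptic_elim m q e (initial q)).2 = #|G|.
Proof.
move=> eP; rewrite elliptic_elimE.
have ind := independent_choices q_surj q_order eP.
set P := eliminate_all _ _ _ _.
have ug := uniq_schreier_gens q.
have memP s : (s \in P.1) = (s \in gens) && (s \notin map (@target g0 r) (choices e)).
  exact: mem_eliminate_all.
have faceE psi : elliptic_closed q m psi ->
    map (wt psi) P.2 = map (face_wt q psi) reps.
  move=> cpsi; rewrite /P wt_eliminate_all //; first by rewrite -map_comp.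
  by move=> it itP; have [KP _ _ _] := ind.1 it itP; apply: cpsi.
have countR s b : s.1 \in reps -> ~~ Mgen q s ->
    count_mem (s, b) (flatten (initial q).2) =
    nat_of_bool (if s.2 is inl _ then ~~ b else true).
  by move=> sP sM; rewrite count_R_relations ?ev_surface_rel // count_surface_rel.
split; last first.
  have /(congr1 size) := faceE (fun=> 0%R) (fun _ _ _ => wt0 _).
  by rewrite !size_map size_reps.
split.
- by split=> [|s]; [exact: uniq_eliminate_all|rewrite memP => /andP[]].
- by apply: presents_eliminate_all => //; apply: presents_initial.
- move=> s b; rewrite memP mem_schreier_gens => /andP[sP sL] sM.
  rewrite (count_eliminate_all q_surj q_order) //.
    rewrite countR // (count_owns eP) //.
    by case: (s.2) => _; case: b; rewrite ?muln0.
  move=> it itP; have [_ tP tM /andP[/eqP t2 _]] := ind.1 it itP.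
  by rewrite !countR // t2.
have := nil_reps q_surj; case repsE : reps => [//|K0 rest] _.
exists [:: K0], rest; split=> // psi /faceE ->.
by rewrite repsE /= big_seq1.
Qed.
End Assembly.

Theorem theorem9p1 (g g0 r n : nat) (Gamma0 : groupType) (G : finGroupType)
    (c : fuchs_gen g0 r -> Gamma0) (m : 'I_r -> nat)
    (phi : {multiplicative Gamma0 -> G})
    (g_ge2 : (2 <= g)%N)
    (cardG : #|G| = n)
    (m_ge2 : forall i, (2 <= m i)%N)
    (m_sorted : forall i j : 'I_r, (i <= j)%N -> (m i <= m j)%N)
    (pres0 : presents (fun _ => True) (enum (fuchs_gen g0 r)) c (rels0 g0 r m))
    (phi_surj : forall y : G, exists u : Gamma0, phi u = y)
    (phi_order : forall i : 'I_r, #[phi (c (gx g0 i))] = m i)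
    (genus_S : quotient_genus (in_kernel phi) g) :
  let q := fun v => phi (c v) in
  (exists e, elliptic_choice m q e) /\
  forall e, elliptic_choice m q e ->
    let gens := (algorithm m q e).1 in
    let rels := (algorithm m q e).2 in
    exists W,
    [/\ size gens = (2 * g)%N /\ uniq gens,
        rels = [:: W],
        presents (in_kernel phi) gens (fun s => ev c (schreier_word q s)) rels
      & forall s, s \in gens -> (s, false) \in W /\ (s, true) \in W].
Proof.
move=> q.
have q_surj y : exists Y, ev q Y = y.
  have [u <-] := phi_surj y; have [_ gen0 _ _] := pres0.
  by have [Y _ <-] := gen0 u I; exists Y; rewrite ev_morph.
split=> [|e eP gens rels]; first exact: elliptic_choice_ex q_surj phi_order.
have evR := ev_surface_rel phi pres0.
have [gluedP szP] := glued_elliptic pres0 q_surj phi_order eP.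
have G0 : (0 < #|G|)%N by rewrite (cardD1 1).
have [] := glued_iter q_surj phi_order evR gluedP (k := #|G|.-1).
  by rewrite szP prednK.
rewrite /gens /rels /algorithm; case: (iter _ _ _) => gs [|W [|//]] //.
case=> [[ugs _] presP cnt _] _; have presM := presents_M_elim presP.
exists [seq l <- W | ~~ Mgen q l.1].
have mem s b : s \in (M_elim q (gs, [:: W])).1 ->
    count_mem (s, b) [seq l <- W | ~~ Mgen q l.1] = 1%N.
  rewrite mem_filter => /andP[sM sg]; rewrite -(cnt s b sg sM) /= cats0 count_filter.
  by apply: eq_count => l /=; case: eqP => // ->.
have ug : uniq (M_elim q (gs, [:: W])).1 by apply: filter_uniq.
split=> //; last first.
  by move=> s sP; rewrite -!has_pred1 !has_count !mem.
split=> //; apply: (size_genus presM ug _ _ _ _ genus_S).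
- by move=> s sP; rewrite wt_dirac !mem.
- exact: mult1.
- by move=> u v; rewrite /in_kernel gmulfM => -> ->; rewrite mulg1.
by move=> u; rewrite /in_kernel multV => ->; rewrite invg1.
Qed.
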